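(* One has a canonical Lie algebra isomorphism $$\mathrm{GVect}_{\mathrm{ar}}(D^2)/\mathrm{Vect}_{\mathrm{az}}(D^2)\;\cong\;\mathrm{Vect}(S^1)\ltimes(\mathrm{Vect}(S^1))_{\mathrm{ab}},$$ where $(\mathrm{Vect}(S^1))_{\mathrm{ab}}$ denotes the abelian Lie algebra with underlying vector space $\mathrm{Vect}(S^1)$, and the action of $\mathrm{Vect}(S^1)$ on $(\mathrm{Vect}(S^1))_{\mathrm{ab}}$ is given by $$\left(v(\theta)\tfrac{\partial}{\partial\theta}\right).\left(w(\theta)\tfrac{\partial}{\partial\theta}\right):=v(\theta)w'(\theta)\tfrac{\partial}{\partial\theta}$$ for each $v(\theta)\frac{\partial}{\partial\theta}\in\mathrm{Vect}(S^1)$ and $w(\theta)\frac{\partial}{\partial\theta}\in(\mathrm{Vect}(S^1))_{\mathrm{ab}}$, with $w'(\theta)=\frac{\partial w(\theta)}{\partial\theta}$.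
   Context: $\mathrm{Vect}(S^1)=\{v(\theta)\frac{\partial}{\partial\theta}: v\in C^\infty(\mathbb{R}/2\pi\mathbb{Z};\mathbb{R})\}$ with bracket $[v\frac{\partial}{\partial\theta},w\frac{\partial}{\partial\theta}]=(vw'-v'w)\frac{\partial}{\partial\theta}$. $D^2$ is the open unit disc in $\mathbb{R}^2$, $S^1=\partial D^2$. $\mathrm{GVect}(D^2)$ is the real Lie algebra (under the usual commutator of vector fields) of all $V=V_1\frac{\partial}{\partial x}+V_2\frac{\partial}{\partial y}$ with $V_1,V_2\in C^\infty(D^2;\mathbb{R})$. In polar coordinates $(r,\theta)$ on $D^2\setminus\{0\}$ write $V=V_3(r,\theta)\frac{\partial}{\partial r}+V_4(r,\theta)\frac{\partial}{\partial\theta}$. $\mathrm{GVect}_{\mathrm{ar}}(D^2)$ is the Lie subalgebra of those $V$ such that $V_1,V_2$ extend continuously to $\overline{D^2}$ and $\partial_rV_3\equiv0\equiv\partial_rV_4$ on some neighborhood of $S^1$ in $\overline{D^2}$; $\mathrm{Vect}_{\mathrm{az}}(D^2)$ is the ideal in it of those $V$ with $V_3\equiv0\equiv V_4$ on some neighborhood of $S^1$ in $\overline{D^2}$. For Lie algebras $\mathfrak{g},\mathfrak{h}$ and a Lie algebra map $\pi:\mathfrak{g}\to\mathrm{Der}(\mathfrak{h})$ to the derivations of $\mathfrak{h}$, the semidirect product $\mathfrak{g}\ltimes\mathfrak{h}$ is $\mathfrak{g}\times\mathfrak{h}$ with bracket $[(v_1,w_1),(v_2,w_2)]=([v_1,v_2],\,[w_1,w_2]+\pi(v_1)(w_2)-\pi(v_2)(w_1))$.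 *)

(* Defs.v *)
From Stdlib Require Import Reals Lra Lia ZArith List.
From Stdlib Require Import Classical ClassicalEpsilon FunctionalExtensionality
  PropExtensionality ProofIrrelevance.
From Coquelicot Require Import Coquelicot.
Open Scope R_scope.

Set Implicit Arguments.
Unset Strict Implicit.

Section AbelianGroupTheory.
Variable G : AbelianGroup.

Lemma minus_plus2 (a b c d : G) :
  minus (plus a b) (plus c d) = plus (minus a c) (minus b d).
Proof.
unfold minus; rewrite opp_plus, <- !plus_assoc; f_equal.
rewrite !plus_assoc; f_equal; apply plus_comm.
Qed.

Lemma opp_minus2 (a b : G) : opp (minus a b) = minus (opp a) (opp b).
Proof. unfold minus; apply opp_plus. Qed.

Lemma plus_eq_zero_opp (x y : G) : plus x y = zero -> x = opp y.
Proof.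
intros H; apply (plus_reg_r y); rewrite H; symmetry; apply plus_opp_l.
Qed.
End AbelianGroupTheory.

(* [abel] decides equalities between linear combinations with coefficients
   [+1] and [-1]. *)
Inductive aexp := AZero | AVar (i : nat) | APlus (a b : aexp) | AOpp (a : aexp).

Section Abel.
Variable E : ModuleSpace R_Ring.

Fixpoint aden (env : list E) (e : aexp) : E :=
  match e with
  | AZero => zero
  | AVar i => nth i env zero
  | APlus a b => plus (aden env a) (aden env b)
  | AOpp a => opp (aden env a)
  end.

Fixpoint acoef (e : aexp) (i : nat) : Z :=
  match e with
  | AZero => 0
  | AVar j => if Nat.eqb i j then 1 else 0
  | APlus a b => acoef a i + acoef b i
  | AOpp a => - acoef a i
  end.

Fixpoint asum (env : list E) (c : nat -> Z) : E :=
  match env with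
  | nil => zero
  | v :: env => plus (scal (IZR (c 0%nat)) v) (asum env (fun i => c (S i)))
  end.

Lemma asum_zero env : asum env (fun _ => 0%Z) = zero.
Proof.
induction env as [|v env IH]; simpl; [easy|].
rewrite IH, plus_zero_r; exact (scal_zero_l v).
Qed.

Lemma asum_plus env c d :
  asum env (fun i => c i + d i)%Z = plus (asum env c) (asum env d).
Proof.
revert c d; induction env as [|v env IH]; intros c d; simpl.
- now rewrite plus_zero_l.
- rewrite IH, plus_IZR.
  change (IZR (c 0%nat) + IZR (d 0%nat)) with (plus (IZR (c 0%nat)) (IZR (d 0%nat))).
  rewrite (scal_distr_r (K := R_Ring)), <- !plus_assoc; f_equal.
  rewrite !plus_assoc; f_equal; apply plus_comm.
Qed.

Lemma asum_opp env c : asum env (fun i => - c i)%Z = opp (asum env c).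
Proof.
revert c; induction env as [|v env IH]; intros c; simpl.
- symmetry; exact (@opp_zero (ModuleSpace.AbelianGroup _ E)).
- rewrite IH, opp_IZR.
  change (- IZR (c 0%nat)) with (opp (IZR (c 0%nat))).
  rewrite (scal_opp_l (K := R_Ring)); symmetry.
  exact (opp_plus (scal (IZR (c 0%nat)) v) (asum env (fun i => c (S i)))).
Qed.

Lemma aden_asum env e : aden env e = asum env (acoef e).
Proof.
induction e as [|j|a IHa b IHb|a IH]; simpl.
- symmetry; apply asum_zero.
- revert j; induction env as [|v env IH]; intros [|j]; simpl; try easy.
  + rewrite asum_zero, plus_zero_r; symmetry; exact (scal_one v).
  + rewrite (scal_zero_l v : scal 0 v = zero), plus_zero_l; apply IH.
- rewrite IHa, IHb; symmetry; apply asum_plus.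
- rewrite IH; symmetry; apply asum_opp.
Qed.

Fixpoint acheck (n : nat) (c d : nat -> Z) : bool :=
  match n with
  | O => true
  | S n => Z.eqb (c 0%nat) (d 0%nat) && acheck n (fun i => c (S i)) (fun i => d (S i))
  end.

Lemma acheckP env e1 e2 :
  acheck (length env) (acoef e1) (acoef e2) = true -> aden env e1 = aden env e2.
Proof.
intros H; rewrite !aden_asum.
revert H; generalize (acoef e1) (acoef e2).
induction env as [|v env IH]; intros c d H; simpl; [easy|].
simpl in H; apply andb_prop in H; destruct H as [H0 H].
apply Z.eqb_eq in H0; rewrite H0; f_equal; now apply IH.
Qed.
End Abel.

Ltac abel_find x env :=
  match env with
  | x :: _ => constr:(O)
  | _ :: ?env' => let n := abel_find x env' in constr:(S n)
  end.
Ltac abel_add x env :=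
  match env with
  | _ => let n := abel_find x env in env
  | _ => constr:(x :: env)
  end.
Ltac abel_atoms e env :=
  lazymatch e with
  | zero => env
  | plus ?a ?b => let env := abel_atoms a env in abel_atoms b env
  | minus ?a ?b => let env := abel_atoms a env in abel_atoms b env
  | opp ?a => abel_atoms a env
  | _ => abel_add e env
  end.
Ltac abel_reify e env :=
  lazymatch e with
  | zero => constr:(AZero)
  | plus ?a ?b =>
      let a := abel_reify a env in let b := abel_reify b env in constr:(APlus a b)
  | minus ?a ?b =>
      let a := abel_reify a env in let b := abel_reify b env in
      constr:(APlus a (AOpp b))
  | opp ?a => let a := abel_reify a env in constr:(AOpp a)
  | _ => let n := abel_find e env in constr:(AVar n)
  end.
Ltac abel E :=
  match goal with
  | |- ?a = ?b =>
      let env := abel_atoms a (@nil (ModuleSpace.sort R_Ring E)) in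
      let env := abel_atoms b env in
      let ra := abel_reify a env in let rb := abel_reify b env in
      exact (@acheckP E env ra rb eq_refl)
  end.

Section FunctionSpace.
Variables (T : Type) (E : ModuleSpace R_Ring).

Definition fct_AbelianMonoid_mixin : AbelianMonoid.mixin_of (T -> E).
Proof.
refine (@AbelianMonoid.Mixin (T -> E)
  (fun f g t => plus (f t) (g t)) (fun _ => zero) _ _ _);
  intros; apply functional_extensionality; intros t.
- apply plus_comm.
- apply plus_assoc.
- apply plus_zero_r.
Defined.

Definition fct_AbelianGroup_mixin :
  AbelianGroup.mixin_of (AbelianMonoid.Pack (T -> E) fct_AbelianMonoid_mixin (T -> E)).
Proof.
refine (@AbelianGroup.Mixin
  (AbelianMonoid.Pack (T -> E) fct_AbelianMonoid_mixin (T -> E))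
  (fun f t => opp (f t)) _).
intros f; apply functional_extensionality; intros t; exact (plus_opp_r (f t)).
Defined.

Definition fct_AbelianGroup : AbelianGroup :=
  AbelianGroup.Pack (T -> E)
    (AbelianGroup.Class (T -> E) _ fct_AbelianGroup_mixin) (T -> E).

Definition fct_ModuleSpace_mixin :
  ModuleSpace.mixin_of R_Ring fct_AbelianGroup.
Proof.
refine (@ModuleSpace.Mixin R_Ring fct_AbelianGroup
  (fun c f t => scal c (f t)) _ _ _ _);
  intros; apply functional_extensionality; intros t.
- exact (scal_assoc x y (u t)).
- exact (scal_one (u t)).
- exact (scal_distr_l x (u t) (v t)).
- exact (scal_distr_r x y (u t)).
Defined.

Definition fct_ModuleSpace : ModuleSpace R_Ring :=
  ModuleSpace.Pack R_Ring (T -> E)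
    (ModuleSpace.Class R_Ring (T -> E) _ fct_ModuleSpace_mixin) (T -> E).
End FunctionSpace.

Record subspace (E : ModuleSpace R_Ring) := {
  sub_mem :> E -> Prop;
  sub_zero : sub_mem zero;
  sub_plus : forall x y, sub_mem x -> sub_mem y -> sub_mem (plus x y);
  sub_scal : forall (c : R) x, sub_mem x -> sub_mem (scal c x) }.

Section SubspaceTheory.
Variables (E : ModuleSpace R_Ring) (S : subspace E).

Lemma sub_opp x : S x -> S (opp x).
Proof.
intros Sx; rewrite <- scal_opp_one.
apply sub_scal; exact Sx.
Qed.

Lemma sub_minus x y : S x -> S y -> S (minus x y).
Proof. intros Sx Sy; apply sub_plus; [exact Sx|apply sub_opp; exact Sy]. Qed.

Lemma sig_ext (x y : {z : E | S z}) : proj1_sig x = proj1_sig y -> x = y.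
Proof.
destruct x as [x Sx], y as [y Sy]; simpl; intros <-.
now rewrite (proof_irrelevance _ Sx Sy).
Qed.

Definition sub_AbelianMonoid_mixin : AbelianMonoid.mixin_of {x : E | S x}.
Proof.
refine (@AbelianMonoid.Mixin {x : E | S x}
  (fun x y => exist _ (plus (proj1_sig x) (proj1_sig y))
                (sub_plus (proj2_sig x) (proj2_sig y)))
  (exist _ zero (sub_zero S)) _ _ _);
  intros; apply sig_ext; simpl.
- apply plus_comm.
- apply plus_assoc.
- apply plus_zero_r.
Defined.

Definition sub_AbelianGroup_mixin :
  AbelianGroup.mixin_of (AbelianMonoid.Pack {x : E | S x} sub_AbelianMonoid_mixin {x : E | S x}).
Proof.
refine (@AbelianGroup.Mixin
  (AbelianMonoid.Pack {x : E | S x} sub_AbelianMonoid_mixin {x : E | S x})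
  (fun x => exist _ (opp (proj1_sig x)) (sub_opp (proj2_sig x))) _).
intros x; apply sig_ext; exact (plus_opp_r (proj1_sig x)).
Defined.

Definition sub_AbelianGroup : AbelianGroup :=
  AbelianGroup.Pack {x : E | S x}
    (AbelianGroup.Class {x : E | S x} _ sub_AbelianGroup_mixin) {x : E | S x}.

Definition sub_ModuleSpace_mixin :
  ModuleSpace.mixin_of R_Ring sub_AbelianGroup.
Proof.
refine (@ModuleSpace.Mixin R_Ring sub_AbelianGroup
  (fun c x => exist _ (scal c (proj1_sig x)) (sub_scal c (proj2_sig x)))
  _ _ _ _); intros; apply sig_ext.
- exact (scal_assoc x y (proj1_sig u)).
- exact (scal_one (proj1_sig u)).
- exact (scal_distr_l x (proj1_sig u) (proj1_sig v)).
- exact (scal_distr_r x y (proj1_sig u)).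
Defined.

Definition sub_ModuleSpace : ModuleSpace R_Ring :=
  ModuleSpace.Pack R_Ring {x : E | S x}
    (ModuleSpace.Class R_Ring {x : E | S x} _ sub_ModuleSpace_mixin) {x : E | S x}.

(* Points of the quotient by [S] are cosets.  The operations are computed on
   chosen representatives; by [quot_clsP] the choice does not matter. *)

Definition coset (x : E) : E -> Prop := fun y => S (minus y x).

Definition quot_carrier : Type :=
  {A : E -> Prop | exists x, A = coset x}.

Definition quot_cls (x : E) : quot_carrier :=
  exist _ (coset x) (ex_intro _ x eq_refl).

Definition quot_rep (A : quot_carrier) : E :=
  proj1_sig (constructive_indefinite_description _ (proj2_sig A)).

Lemma quot_repK A : quot_cls (quot_rep A) = A.
Proof.
unfold quot_rep.
destruct (constructive_indefinite_description _ (proj2_sig A)) as [x Ax]; simpl.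
destruct A as [A HA]; simpl in Ax; subst A.
unfold quot_cls; f_equal; apply proof_irrelevance.
Qed.

Lemma quot_clsP x y : quot_cls x = quot_cls y <-> S (minus x y).
Proof.
split.
- intros H; apply (f_equal (@proj1_sig _ _)) in H; simpl in H.
  change (coset y x); rewrite <- H; unfold coset.
  rewrite minus_eq_zero; apply sub_zero.
- intros H.
  assert (e : coset x = coset y).
  { apply functional_extensionality; intros z.
    apply propositional_extensionality; unfold coset; split; intros Hz.
    - rewrite (minus_trans x z y); now apply sub_plus.
    - rewrite (minus_trans y z x); apply sub_plus; [exact Hz|].
      rewrite <- opp_minus; now apply sub_opp. }
  unfold quot_cls.
  generalize (ex_intro (fun t => coset x = coset t) x eq_refl).
  rewrite e; intros p; f_equal; apply proof_irrelevance.
Qed.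

Lemma quot_rep_cls x : S (minus (quot_rep (quot_cls x)) x).
Proof. apply quot_clsP; apply quot_repK. Qed.

Definition quot_plus (A B : quot_carrier) := quot_cls (plus (quot_rep A) (quot_rep B)).
Definition quot_opp (A : quot_carrier) := quot_cls (opp (quot_rep A)).
Definition quot_scal (c : R) (A : quot_carrier) := quot_cls (scal c (quot_rep A)).

Lemma quot_plus_cls x y : quot_plus (quot_cls x) (quot_cls y) = quot_cls (plus x y).
Proof.
apply quot_clsP; rewrite minus_plus2.
apply sub_plus; apply quot_rep_cls.
Qed.

Lemma quot_opp_cls x : quot_opp (quot_cls x) = quot_cls (opp x).
Proof.
apply quot_clsP.
pose proof (sub_opp (quot_rep_cls x)) as H.
rewrite opp_minus2 in H; exact H.
Qed.

Lemma quot_scal_cls c x : quot_scal c (quot_cls x) = quot_cls (scal c x).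
Proof.
apply quot_clsP; rewrite <- (@scal_minus_distr_l R_Ring E).
apply sub_scal; apply quot_rep_cls.
Qed.

Definition quot_AbelianMonoid_mixin : AbelianMonoid.mixin_of quot_carrier.
Proof.
refine (@AbelianMonoid.Mixin quot_carrier quot_plus (quot_cls zero) _ _ _).
- intros A B; unfold quot_plus; f_equal; apply plus_comm.
- intros A B C; rewrite <- (quot_repK A), <- (quot_repK B), <- (quot_repK C).
  rewrite !quot_plus_cls; f_equal; apply plus_assoc.
- intros A; rewrite <- (quot_repK A), quot_plus_cls; f_equal; apply plus_zero_r.
Defined.

Definition quot_AbelianGroup_mixin :
  AbelianGroup.mixin_of (AbelianMonoid.Pack quot_carrier quot_AbelianMonoid_mixin quot_carrier).
Proof.
refine (@AbelianGroup.Mixin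
  (AbelianMonoid.Pack quot_carrier quot_AbelianMonoid_mixin quot_carrier) quot_opp _).
intros A; change (quot_plus A (quot_opp A) = quot_cls zero).
rewrite <- (quot_repK A), quot_opp_cls, quot_plus_cls.
f_equal; exact (plus_opp_r (quot_rep A)).
Defined.

Definition quot_AbelianGroup : AbelianGroup :=
  AbelianGroup.Pack quot_carrier
    (AbelianGroup.Class quot_carrier _ quot_AbelianGroup_mixin) quot_carrier.

Definition quot_ModuleSpace_mixin :
  ModuleSpace.mixin_of R_Ring quot_AbelianGroup.
Proof.
refine (@ModuleSpace.Mixin R_Ring quot_AbelianGroup quot_scal _ _ _ _).
- intros c d A; rewrite <- (quot_repK A), !quot_scal_cls; f_equal; apply scal_assoc.
- intros A; rewrite <- (quot_repK A), quot_scal_cls; f_equal; apply scal_one.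
- intros c A B; change (quot_scal c (quot_plus A B)
    = quot_plus (quot_scal c A) (quot_scal c B)).
  rewrite <- (quot_repK A), <- (quot_repK B).
  rewrite !quot_scal_cls, !quot_plus_cls, quot_scal_cls; f_equal; apply scal_distr_l.
- intros c d A; change (quot_scal (plus c d) A
    = quot_plus (quot_scal c A) (quot_scal d A)).
  rewrite <- (quot_repK A), !quot_scal_cls, quot_plus_cls; f_equal.
  apply (@scal_distr_r R_Ring E).
Defined.

Definition quot_ModuleSpace : ModuleSpace R_Ring :=
  ModuleSpace.Pack R_Ring quot_carrier
    (ModuleSpace.Class R_Ring quot_carrier _ quot_ModuleSpace_mixin) quot_carrier.
End SubspaceTheory.

Record LieAlgebra := {
  lie_space :> ModuleSpace R_Ring;
  bracket : lie_space -> lie_space -> lie_space;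
  bracket_plus_l : forall x y z,
    bracket (plus x y) z = plus (bracket x z) (bracket y z);
  bracket_scal_l : forall (c : R) x y,
    bracket (scal c x) y = scal c (bracket x y);
  bracket_plus_r : forall x y z,
    bracket x (plus y z) = plus (bracket x y) (bracket x z);
  bracket_scal_r : forall (c : R) x y,
    bracket x (scal c y) = scal c (bracket x y);
  bracket_alt : forall x, bracket x x = zero;
  bracket_jacobi : forall x y z,
    plus (bracket x (bracket y z))
      (plus (bracket y (bracket z x)) (bracket z (bracket x y))) = zero }.

Section LieTheory.
Variable L : LieAlgebra.

Lemma bracket_anti (x y : L) : bracket x y = opp (bracket y x).
Proof.
apply plus_eq_zero_opp.
pose proof (bracket_alt (plus x y)) as H.
rewrite bracket_plus_l, !bracket_plus_r, !bracket_alt in H.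
now rewrite plus_zero_l, plus_zero_r in H.
Qed.

Lemma bracket_opp_l (x y : L) : bracket (opp x) y = opp (bracket x y).
Proof. now rewrite <- !scal_opp_one, <- bracket_scal_l. Qed.

Lemma bracket_opp_r (x y : L) : bracket x (opp y) = opp (bracket x y).
Proof. now rewrite <- !scal_opp_one, <- bracket_scal_r. Qed.

Lemma bracket_minus_l (x y z : L) :
  bracket (minus x y) z = minus (bracket x z) (bracket y z).
Proof. unfold minus; now rewrite bracket_plus_l, bracket_opp_l. Qed.

Lemma bracket_minus_r (x y z : L) :
  bracket x (minus y z) = minus (bracket x y) (bracket x z).
Proof. unfold minus; now rewrite bracket_plus_r, bracket_opp_r. Qed.
End LieTheory.

Record subalgebra (L : LieAlgebra) := {
  subalg_space :> subspace L;
  subalg_bracket : forall x y,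
    subalg_space x -> subalg_space y -> subalg_space (bracket x y) }.

Record ideal (L : LieAlgebra) := {
  ideal_space :> subspace L;
  ideal_bracket : forall x y, ideal_space y -> ideal_space (bracket x y) }.

Definition subalgebra_lie (L : LieAlgebra) (S : subalgebra L) : LieAlgebra.
Proof.
refine (@Build_LieAlgebra (sub_ModuleSpace S)
  (fun x y => exist _ (bracket (proj1_sig x) (proj1_sig y))
                (subalg_bracket (proj2_sig x) (proj2_sig y))) _ _ _ _ _ _);
  intros; apply sig_ext; simpl.
- apply bracket_plus_l.
- apply bracket_scal_l.
- apply bracket_plus_r.
- apply bracket_scal_r.
- apply bracket_alt.
- apply bracket_jacobi.
Defined.

Section QuotientLie.
Variables (L : LieAlgebra) (I : ideal L).

Definition quot_bracket (A B : quot_ModuleSpace I) : quot_ModuleSpace I :=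
  quot_cls I (bracket (quot_rep A) (quot_rep B)).

Lemma quot_bracket_cls x y :
  quot_bracket (quot_cls I x) (quot_cls I y) = quot_cls I (bracket x y).
Proof.
apply quot_clsP.
rewrite (minus_trans (bracket (quot_rep (quot_cls I x)) y)).
rewrite <- bracket_minus_r, <- bracket_minus_l.
apply sub_plus.
- apply ideal_bracket; apply quot_rep_cls.
- rewrite bracket_anti; apply sub_opp; apply ideal_bracket; apply quot_rep_cls.
Qed.

Definition quotient_lie : LieAlgebra.
Proof.
refine (@Build_LieAlgebra (quot_ModuleSpace I) quot_bracket _ _ _ _ _ _).
- intros A B C; change (quot_bracket (quot_plus A B) C
    = quot_plus (quot_bracket A C) (quot_bracket B C)).
  rewrite <- (quot_repK A), <- (quot_repK B), <- (quot_repK C).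
  rewrite !quot_plus_cls, !quot_bracket_cls, quot_plus_cls.
  f_equal; apply bracket_plus_l.
- intros c A B; change (quot_bracket (quot_scal c A) B
    = quot_scal c (quot_bracket A B)).
  rewrite <- (quot_repK A), <- (quot_repK B).
  rewrite !quot_scal_cls, !quot_bracket_cls, quot_scal_cls.
  f_equal; apply bracket_scal_l.
- intros A B C; change (quot_bracket A (quot_plus B C)
    = quot_plus (quot_bracket A B) (quot_bracket A C)).
  rewrite <- (quot_repK A), <- (quot_repK B), <- (quot_repK C).
  rewrite !quot_plus_cls, !quot_bracket_cls, quot_plus_cls.
  f_equal; apply bracket_plus_r.
- intros c A B; change (quot_bracket A (quot_scal c B)
    = quot_scal c (quot_bracket A B)).
  rewrite <- (quot_repK A), <- (quot_repK B).
  rewrite !quot_scal_cls, !quot_bracket_cls, quot_scal_cls.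
  f_equal; apply bracket_scal_r.
- intros A; rewrite <- (quot_repK A), quot_bracket_cls.
  change (quot_cls I (bracket (quot_rep A) (quot_rep A)) = quot_cls I zero).
  f_equal; apply bracket_alt.
- intros A B C; change (quot_plus (quot_bracket A (quot_bracket B C))
    (quot_plus (quot_bracket B (quot_bracket C A))
       (quot_bracket C (quot_bracket A B))) = quot_cls I zero).
  rewrite <- (quot_repK A), <- (quot_repK B), <- (quot_repK C).
  rewrite !quot_bracket_cls, !quot_plus_cls; f_equal; apply bracket_jacobi.
Defined.

Definition quotient_map (x : L) : quotient_lie := quot_cls I x.
End QuotientLie.

Definition abelian_lie (E : ModuleSpace R_Ring) : LieAlgebra.
Proof.
refine (@Build_LieAlgebra E (fun _ _ => zero) _ _ _ _ _ _); intros.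
- now rewrite plus_zero_l.
- symmetry; apply (@scal_zero_r R_Ring E).
- now rewrite plus_zero_l.
- symmetry; apply (@scal_zero_r R_Ring E).
- reflexivity.
- now rewrite !plus_zero_l.
Defined.

(* A Lie algebra map [g -> Der(h)] in uncurried form: [act_plus_r],
   [act_scal_r] and [act_der] say that each [act x] is a derivation of [h], the
   remaining fields that [x |-> act x] is a morphism into the commutator
   algebra of derivations. *)
Record lie_action (g h : LieAlgebra) := {
  act :> g -> h -> h;
  act_plus_r : forall x u v, act x (plus u v) = plus (act x u) (act x v);
  act_scal_r : forall x (c : R) u, act x (scal c u) = scal c (act x u);
  act_der : forall x u v,
    act x (bracket u v) = plus (bracket (act x u) v) (bracket u (act x v));
  act_plus_l : forall x y u, act (plus x y) u = plus (act x u) (act y u);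
  act_scal_l : forall (c : R) x u, act (scal c x) u = scal c (act x u);
  act_bracket : forall x y u,
    act (bracket x y) u = minus (act x (act y u)) (act y (act x u)) }.

Lemma act_opp_r (g h : LieAlgebra) (p : lie_action g h) x u :
  p x (opp u) = opp (p x u).
Proof. now rewrite <- !scal_opp_one, <- act_scal_r. Qed.

Lemma pair_eq (A B : Type) (a b : A * B) :
  fst a = fst b -> snd a = snd b -> a = b.
Proof. destruct a, b; simpl; now intros -> ->. Qed.

Definition semidirect (g h : LieAlgebra) (p : lie_action g h) : LieAlgebra.
Proof.
refine (@Build_LieAlgebra (prod_ModuleSpace R_Ring g h)
  (fun a b => (bracket (fst a) (fst b),
     minus (plus (bracket (snd a) (snd b)) (p (fst a) (snd b)))
       (p (fst b) (snd a)))) _ _ _ _ _ _).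
- intros [x1 u1] [x2 u2] [x3 u3]; apply pair_eq; simpl.
  + apply bracket_plus_l.
  + rewrite bracket_plus_l, act_plus_l, act_plus_r; abel h.
- intros c [x1 u1] [x2 u2]; apply pair_eq; simpl.
  + apply bracket_scal_l.
  + rewrite bracket_scal_l, act_scal_l, act_scal_r.
    now rewrite (scal_minus_distr_l (K := R_Ring)), (scal_distr_l (K := R_Ring)).
- intros [x1 u1] [x2 u2] [x3 u3]; apply pair_eq; simpl.
  + apply bracket_plus_r.
  + rewrite bracket_plus_r, act_plus_l, act_plus_r; abel h.
- intros c [x1 u1] [x2 u2]; apply pair_eq; simpl.
  + apply bracket_scal_r.
  + rewrite bracket_scal_r, act_scal_l, act_scal_r.
    now rewrite (scal_minus_distr_l (K := R_Ring)), (scal_distr_l (K := R_Ring)).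
- intros [x u]; apply pair_eq; simpl.
  + apply bracket_alt.
  + rewrite bracket_alt; abel h.
- intros [x1 u1] [x2 u2] [x3 u3]; apply pair_eq; simpl.
  + apply bracket_jacobi.
  + assert (J : forall a b c : h, bracket a (bracket b c) = minus (opp (bracket b (bracket c a))) (bracket c (bracket a b))).
    { intros a b c; transitivity (minus (plus (bracket a (bracket b c))
      (plus (bracket b (bracket c a)) (bracket c (bracket a b)))) (plus (bracket b (bracket c a)) (bracket c (bracket a b)))); [abel h|].
      rewrite bracket_jacobi; abel h. }
    rewrite !act_bracket; unfold minus.
    rewrite !act_plus_r, !act_opp_r, !bracket_plus_r, !bracket_opp_r, !act_der.
    rewrite (J u1 u2 u3), (bracket_anti (p x1 u2) u3), (bracket_anti (p x2 u3) u1), (bracket_anti (p x3 u1) u2).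
    abel h.
Defined.

Record is_lie_iso (g h : LieAlgebra) (f : g -> h) : Prop := {
  iso_plus : forall x y, f (plus x y) = plus (f x) (f y);
  iso_scal : forall (c : R) x, f (scal c x) = scal c (f x);
  iso_bracket : forall x y, f (bracket x y) = bracket (f x) (f y);
  iso_inj : forall x y, f x = f y -> x = y;
  iso_surj : forall y, exists x, f x = y }.

Definition R_space : ModuleSpace R_Ring := R_ModuleSpace.

Definition smooth1 (v : R -> R) : Prop := forall n t, ex_derive_n v n t.

Definition periodic (v : R -> R) : Prop := forall t, v (t + 2 * PI) = v t.

Lemma Derive_n_Derive (f : R -> R) n x : Derive_n (Derive f) n x = Derive_n f (S n) x.
Proof.
change (Derive f) with (Derive_n f 1).
rewrite Derive_n_comp; f_equal; lia.
Qed.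

Lemma smooth1_Derive f : smooth1 f -> smooth1 (Derive f).
Proof.
intros Hf [|n] x; [easy|].
apply (ex_derive_ext (Derive_n f (S n))); [|apply (Hf (S (S n)))].
intros t; now rewrite Derive_n_Derive.
Qed.

Lemma smooth1_ex f x : smooth1 f -> ex_derive f x.
Proof. intros Hf; apply (Hf 1%nat). Qed.

Lemma ex_derive_n_S f n :
  (forall x, ex_derive f x) -> (forall x, ex_derive_n (Derive f) n x) ->
  forall x, ex_derive_n f (S n) x.
Proof.
intros Hf HD x; destruct n as [|n]; [apply Hf|].
apply (ex_derive_ext (Derive_n (Derive f) n)); [|apply HD].
intros t; apply Derive_n_Derive.
Qed.

Lemma smooth1_const c : smooth1 (fun _ => c).
Proof. intros n x; apply ex_derive_n_const. Qed.

Lemma smooth1_plus f g : smooth1 f -> smooth1 g -> smooth1 (fun t => f t + g t).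
Proof.
intros Hf Hg n x; apply ex_derive_n_plus; apply filter_forall; intros t k _; auto.
Qed.

Lemma smooth1_mult f g : smooth1 f -> smooth1 g -> smooth1 (fun t => f t * g t).
Proof.
intros Hf Hg n.
enough (H : forall k, (k <= n)%nat -> forall x, ex_derive_n (fun t => f t * g t) k x)
  by (intros; apply (H n); lia).
revert f g Hf Hg; induction n as [|n IH]; intros f g Hf Hg [|k] Hk; try easy; try lia.
apply ex_derive_n_S.
- intros x; apply ex_derive_mult; now apply smooth1_ex.
- intros x; apply (ex_derive_n_ext (fun t => Derive f t * g t + f t * Derive g t)).
  { intros t; symmetry; apply Derive_mult; now apply smooth1_ex. }
  apply ex_derive_n_plus; apply filter_forall; intros t j Hj; apply IH;
    try lia; auto using smooth1_Derive.
Qed.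

Lemma smooth1_scal c f : smooth1 f -> smooth1 (fun t => c * f t).
Proof. intros Hf; apply smooth1_mult; [apply smooth1_const|exact Hf]. Qed.

Lemma smooth1_minus f g : smooth1 f -> smooth1 g -> smooth1 (fun t => f t - g t).
Proof.
intros Hf Hg n x; apply ex_derive_n_minus; apply filter_forall; intros t k _; auto.
Qed.

Lemma Derive_wronskian f g t : smooth1 f -> smooth1 g ->
  Derive (fun s => f s * Derive g s - Derive f s * g s) t =
  f t * Derive (Derive g) t - Derive (Derive f) t * g t.
Proof.
intros Hf Hg.
pose proof (smooth1_ex t Hf) as ef.
pose proof (smooth1_ex t Hg) as eg.
pose proof (smooth1_ex t (smooth1_Derive Hf)) as ef'.
pose proof (smooth1_ex t (smooth1_Derive Hg)) as eg'.
rewrite Derive_minus by (now apply ex_derive_mult).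
rewrite !Derive_mult by assumption.
ring.
Qed.

Lemma periodic_Derive v : periodic v -> periodic (Derive v).
Proof.
intros Hv t.
rewrite <- (Derive_ext (fun s => v (s + 2 * PI)) v t) by apply Hv.
exact (eq_sym (Derive_n_comp_trans v 1 t (2 * PI))).
Qed.

(* [C^infinity(R/2piZ; R)], as functions of the angle. *)
Definition circle_functions : subspace (fct_ModuleSpace R R_space).
Proof.
refine (@Build_subspace (fct_ModuleSpace R R_space)
  (fun v : R -> R => periodic v /\ smooth1 v) _ _ _).
- split; [easy|]; exact (smooth1_const 0).
- intros v w [pv sv] [pw sw]; split.
  + intros t; exact (f_equal2 Rplus (pv t) (pw t)).
  + exact (smooth1_plus sv sw).
- intros c v [pv sv]; split.
  + intros t; exact (f_equal (Rmult c) (pv t)).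
  + exact (smooth1_scal c sv).
Defined.

Definition circle_space : ModuleSpace R_Ring := sub_ModuleSpace circle_functions.

Definition circle_fun (v : circle_space) : R -> R := proj1_sig v.

Lemma circle_fun_periodic v : periodic (circle_fun v).
Proof. exact (proj1 (proj2_sig v)). Qed.

Lemma circle_fun_smooth v : smooth1 (circle_fun v).
Proof. exact (proj2 (proj2_sig v)). Qed.

Lemma circle_fun_ext (v w : circle_space) : (forall t, circle_fun v t = circle_fun w t) -> v = w.
Proof. intros H; apply sig_ext; now apply functional_extensionality. Qed.

Definition circle_bracket (v w : circle_space) : circle_space.
Proof.
refine (exist _ (fun t => circle_fun v t * Derive (circle_fun w) t - Derive (circle_fun v) t * circle_fun w t) _).
split.
- intros t; now rewrite !circle_fun_periodic, (periodic_Derive (circle_fun_periodic v)),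
    (periodic_Derive (circle_fun_periodic w)).
- exact (smooth1_minus
    (smooth1_mult (circle_fun_smooth v) (smooth1_Derive (circle_fun_smooth w)))
    (smooth1_mult (smooth1_Derive (circle_fun_smooth v)) (circle_fun_smooth w))).
Defined.

Definition circle_act (v w : circle_space) : circle_space.
Proof.
refine (exist _ (fun t => circle_fun v t * Derive (circle_fun w) t) _).
split.
- intros t; now rewrite circle_fun_periodic, (periodic_Derive (circle_fun_periodic w)).
- exact (smooth1_mult (circle_fun_smooth v) (smooth1_Derive (circle_fun_smooth w))).
Defined.

Lemma circle_fun_plus v w t : circle_fun (plus v w) t = circle_fun v t + circle_fun w t.
Proof. reflexivity. Qed.

Lemma circle_fun_scal (c : R) v t : circle_fun (scal c v) t = c * circle_fun v t.
Proof. reflexivity. Qed.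

Lemma circle_fun_zero t : circle_fun zero t = 0.
Proof. reflexivity. Qed.

Lemma circle_fun_minus v w t : circle_fun (minus v w) t = circle_fun v t - circle_fun w t.
Proof. reflexivity. Qed.

Lemma circle_fun_bracket v w t :
  circle_fun (circle_bracket v w) t = circle_fun v t * Derive (circle_fun w) t - Derive (circle_fun v) t * circle_fun w t.
Proof. reflexivity. Qed.

Lemma circle_fun_act v w t : circle_fun (circle_act v w) t = circle_fun v t * Derive (circle_fun w) t.
Proof. reflexivity. Qed.

Lemma circle_fun_ex v t : ex_derive (circle_fun v) t.
Proof. apply smooth1_ex, circle_fun_smooth. Qed.

Lemma circle_fun_ex_Derive v t : ex_derive (Derive (circle_fun v)) t.
Proof. apply smooth1_ex, smooth1_Derive, circle_fun_smooth. Qed.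

Lemma Derive_circle_fun_plus v w t : Derive (circle_fun (plus v w)) t = Derive (circle_fun v) t + Derive (circle_fun w) t.
Proof. apply Derive_plus; apply circle_fun_ex. Qed.

Lemma Derive_circle_fun_scal (c : R) v t : Derive (circle_fun (scal c v)) t = c * Derive (circle_fun v) t.
Proof. apply Derive_scal. Qed.

Lemma Derive_circle_fun_act v w t : Derive (circle_fun (circle_act v w)) t =
  Derive (circle_fun v) t * Derive (circle_fun w) t + circle_fun v t * Derive (Derive (circle_fun w)) t.
Proof. exact (Derive_mult (circle_fun v) (Derive (circle_fun w)) t (circle_fun_ex v t) (circle_fun_ex_Derive w t)). Qed.

Lemma Derive_circle_fun_bracket v w t : Derive (circle_fun (circle_bracket v w)) t =
  circle_fun v t * Derive (Derive (circle_fun w)) t - Derive (Derive (circle_fun v)) t * circle_fun w t.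
Proof.
exact (Derive_wronskian t (circle_fun_smooth v) (circle_fun_smooth w)).
Qed.

Opaque circle_fun circle_bracket circle_act.

Ltac circle_eq :=
  intros; apply circle_fun_ext; intros ?;
  repeat rewrite ?circle_fun_plus, ?circle_fun_scal, ?circle_fun_minus, ?circle_fun_zero, ?circle_fun_bracket, ?circle_fun_act,
    ?Derive_circle_fun_plus, ?Derive_circle_fun_scal, ?Derive_circle_fun_bracket, ?Derive_circle_fun_act;
  ring.

Definition VectS1 : LieAlgebra.
Proof.
refine (@Build_LieAlgebra circle_space circle_bracket _ _ _ _ _ _); circle_eq.
Defined.

Definition VectS1_ab : LieAlgebra := abelian_lie VectS1.

Definition VectS1_action : lie_action VectS1 VectS1_ab.
Proof.
refine (@Build_lie_action VectS1 VectS1_ab circle_act _ _ _ _ _ _);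
  [circle_eq|circle_eq| |circle_eq|circle_eq|].
- intros x u v; change (circle_act x zero = plus zero zero).
  apply circle_fun_ext; intros t; rewrite circle_fun_act, circle_fun_plus, circle_fun_zero.
  replace (Derive (circle_fun zero) t) with 0; [ring|symmetry; exact (Derive_const 0 t)].
- intros x y u; change (circle_act (circle_bracket x y) u
    = minus (circle_act x (circle_act y u)) (circle_act y (circle_act x u))).
  circle_eq.
Defined.

Transparent circle_fun circle_bracket circle_act.

Definition in_disc (x y : R) : Prop := x ^ 2 + y ^ 2 < 1.

(* [C^infinity] on the open unit disc: partial derivatives of all orders exist
   and are continuous. *)
Definition smooth2 (f : R -> R -> R) : Prop :=
  forall n x y, in_disc x y -> ex_diff_n f n x y.

Definition pdx (f : R -> R -> R) : R -> R -> R :=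
  fun x y => Derive (fun t => f t y) x.
Definition pdy (f : R -> R -> R) : R -> R -> R :=
  fun x y => Derive (fun t => f x t) y.

Lemma in_disc_locally x y : in_disc x y -> locally_2d in_disc x y.
Proof.
intros H.
assert (C : continuity_2d_pt (fun u v => u * u + v * v) x y).
{ apply continuity_2d_pt_plus; apply continuity_2d_pt_mult;
    first [apply continuity_2d_pt_id1|apply continuity_2d_pt_id2]. }
assert (e0 : 0 < 1 - (x ^ 2 + y ^ 2)) by (unfold in_disc in H; lra).
destruct (C (mkposreal _ e0)) as [d Hd]; exists d; intros u v Hu Hv.
specialize (Hd u v Hu Hv); simpl in Hd; apply Rabs_def2 in Hd.
unfold in_disc; simpl; lra.
Qed.

Lemma disc_loc (P : R -> R -> Prop) x y :
  in_disc x y -> (forall u v, in_disc u v -> P u v) -> locally_2d P x y.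
Proof.
intros H HP; destruct (in_disc_locally H) as [d Hd].
exists d; auto.
Qed.

Lemma disc_loc_x (P : R -> Prop) x y :
  in_disc x y -> (forall u, in_disc u y -> P u) -> locally x P.
Proof.
intros H HP; destruct (in_disc_locally H) as [d Hd].
exists d; intros u Hu; apply HP, Hd; [exact Hu|].
rewrite Rminus_diag, Rabs_R0; apply cond_pos.
Qed.

Lemma disc_loc_y (P : R -> Prop) x y :
  in_disc x y -> (forall v, in_disc x v -> P v) -> locally y P.
Proof.
intros H HP; destruct (in_disc_locally H) as [d Hd].
exists d; intros v Hv; apply HP, Hd; [|exact Hv].
rewrite Rminus_diag, Rabs_R0; apply cond_pos.
Qed.

Definition cdiff n (f : R -> R -> R) : Prop :=
  forall x y, in_disc x y -> ex_diff_n f n x y.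

Lemma cdiff_S n f :
  (forall x y, in_disc x y -> continuity_2d_pt f x y) ->
  (forall x y, in_disc x y -> ex_derive (fun t => f t y) x) ->
  (forall x y, in_disc x y -> ex_derive (fun t => f x t) y) ->
  cdiff n (pdx f) -> cdiff n (pdy f) -> cdiff (S n) f.
Proof.
intros Hc Hx Hy Hdx Hdy x y H; split; [now apply Hc|].
split; [now apply Hx|split; [now apply Hy|split; [now apply Hdx|now apply Hdy]]].
Qed.

Lemma cdiff_continuous n f x y : cdiff n f -> in_disc x y -> continuity_2d_pt f x y.
Proof. intros Hf H; specialize (Hf x y H); destruct n; apply Hf. Qed.

Lemma cdiff_ex_x n f x y :
  cdiff (S n) f -> in_disc x y -> ex_derive (fun t => f t y) x.
Proof. intros Hf H; apply (Hf x y H). Qed.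

Lemma cdiff_ex_y n f x y :
  cdiff (S n) f -> in_disc x y -> ex_derive (fun t => f x t) y.
Proof. intros Hf H; apply (Hf x y H). Qed.

Lemma cdiff_pdx n f : cdiff (S n) f -> cdiff n (pdx f).
Proof. intros Hf x y H; apply (Hf x y H). Qed.

Lemma cdiff_pdy n f : cdiff (S n) f -> cdiff n (pdy f).
Proof. intros Hf x y H; apply (Hf x y H). Qed.

Lemma cdiff_pred n f : cdiff (S n) f -> cdiff n f.
Proof. intros Hf x y H; apply (ex_diff_n_m (S n)); [lia|now apply Hf]. Qed.

Lemma cdiff_ext n f g :
  (forall x y, in_disc x y -> f x y = g x y) -> cdiff n f -> cdiff n g.
Proof.
intros E Hf x y H; apply (ex_diff_n_ext_loc f); [|now apply Hf].
now apply disc_loc.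
Qed.

Lemma cdiff_const n c : cdiff n (fun _ _ => c).
Proof.
revert c; induction n as [|n IH]; intros c.
- intros x y _; split; [apply continuity_2d_pt_const|easy].
- apply cdiff_S.
  + intros; apply continuity_2d_pt_const.
  + intros; apply ex_derive_const.
  + intros; apply ex_derive_const.
  + apply (cdiff_ext (f := fun _ _ => 0)); [|apply IH].
    intros; symmetry; exact (Derive_const c x).
  + apply (cdiff_ext (f := fun _ _ => 0)); [|apply IH].
    intros; symmetry; exact (Derive_const c y).
Qed.

Lemma cdiff_plus n f g : cdiff n f -> cdiff n g -> cdiff n (fun x y => f x y + g x y).
Proof.
revert f g; induction n as [|n IH]; intros f g Hf Hg.
- intros x y H; split; [|easy].
  apply continuity_2d_pt_plus; [now apply (Hf x y)|now apply (Hg x y)].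
- apply cdiff_S.
  + intros x y H; apply continuity_2d_pt_plus; eapply cdiff_continuous; eauto.
  + intros x y H; exact (ex_derive_plus (fun t => f t y) (fun t => g t y) x
      (cdiff_ex_x Hf H) (cdiff_ex_x Hg H)).
  + intros x y H; exact (ex_derive_plus (fun t => f x t) (fun t => g x t) y
      (cdiff_ex_y Hf H) (cdiff_ex_y Hg H)).
  + apply (cdiff_ext (f := fun x y => pdx f x y + pdx g x y)).
    * intros x y H; symmetry; exact (Derive_plus (fun t => f t y) (fun t => g t y) x
        (cdiff_ex_x Hf H) (cdiff_ex_x Hg H)).
    * apply IH; now apply cdiff_pdx.
  + apply (cdiff_ext (f := fun x y => pdy f x y + pdy g x y)).
    * intros x y H; symmetry; exact (Derive_plus (fun t => f x t) (fun t => g x t) y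
        (cdiff_ex_y Hf H) (cdiff_ex_y Hg H)).
    * apply IH; now apply cdiff_pdy.
Qed.

Lemma cdiff_mult n f g : cdiff n f -> cdiff n g -> cdiff n (fun x y => f x y * g x y).
Proof.
revert f g; induction n as [|n IH]; intros f g Hf Hg.
- intros x y H; split; [|easy].
  apply continuity_2d_pt_mult; [now apply (Hf x y)|now apply (Hg x y)].
- apply cdiff_S.
  + intros x y H; apply continuity_2d_pt_mult; eapply cdiff_continuous; eauto.
  + intros x y H; exact (ex_derive_mult (fun t => f t y) (fun t => g t y) x
      (cdiff_ex_x Hf H) (cdiff_ex_x Hg H)).
  + intros x y H; exact (ex_derive_mult (fun t => f x t) (fun t => g x t) y
      (cdiff_ex_y Hf H) (cdiff_ex_y Hg H)).
  + apply (cdiff_ext (f := fun x y => pdx f x y * g x y + f x y * pdx g x y)).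
    * intros x y H; symmetry; exact (Derive_mult (fun t => f t y) (fun t => g t y) x
        (cdiff_ex_x Hf H) (cdiff_ex_x Hg H)).
    * apply cdiff_plus; apply IH; auto using cdiff_pdx, cdiff_pred.
  + apply (cdiff_ext (f := fun x y => pdy f x y * g x y + f x y * pdy g x y)).
    * intros x y H; symmetry; exact (Derive_mult (fun t => f x t) (fun t => g x t) y
        (cdiff_ex_y Hf H) (cdiff_ex_y Hg H)).
    * apply cdiff_plus; apply IH; auto using cdiff_pdy, cdiff_pred.
Qed.

Lemma smooth2_const c : smooth2 (fun _ _ => c).
Proof. intros n; apply cdiff_const. Qed.

Lemma smooth2_plus f g : smooth2 f -> smooth2 g -> smooth2 (fun x y => f x y + g x y).
Proof. intros Hf Hg n; exact (cdiff_plus (Hf n) (Hg n)). Qed.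

Lemma smooth2_mult f g : smooth2 f -> smooth2 g -> smooth2 (fun x y => f x y * g x y).
Proof. intros Hf Hg n; exact (cdiff_mult (Hf n) (Hg n)). Qed.

Lemma smooth2_scal c f : smooth2 f -> smooth2 (fun x y => c * f x y).
Proof. intros Hf; exact (smooth2_mult (smooth2_const c) Hf). Qed.

Lemma smooth2_ext f g :
  (forall x y, in_disc x y -> f x y = g x y) -> smooth2 f -> smooth2 g.
Proof. intros E Hf n; exact (cdiff_ext E (Hf n)). Qed.

Lemma smooth2_minus f g : smooth2 f -> smooth2 g -> smooth2 (fun x y => f x y - g x y).
Proof.
intros Hf Hg; apply (smooth2_ext (f := fun x y => f x y + (-1) * g x y)).
- intros; ring.
- apply (smooth2_plus Hf (smooth2_scal (-1) Hg)).
Qed.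

Lemma smooth2_pdx f : smooth2 f -> smooth2 (pdx f).
Proof. intros Hf n; exact (cdiff_pdx (Hf (S n))). Qed.

Lemma smooth2_pdy f : smooth2 f -> smooth2 (pdy f).
Proof. intros Hf n; exact (cdiff_pdy (Hf (S n))). Qed.

Lemma smooth2_ex_x f x y : smooth2 f -> in_disc x y -> ex_derive (fun t => f t y) x.
Proof. intros Hf H; exact (cdiff_ex_x (Hf 1%nat) H). Qed.

Lemma smooth2_ex_y f x y : smooth2 f -> in_disc x y -> ex_derive (fun t => f x t) y.
Proof. intros Hf H; exact (cdiff_ex_y (Hf 1%nat) H). Qed.

Lemma smooth2_cont f x y : smooth2 f -> in_disc x y -> continuity_2d_pt f x y.
Proof. intros Hf H; exact (cdiff_continuous (Hf 0%nat) H). Qed.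

Lemma pdx_plus f g x y : smooth2 f -> smooth2 g -> in_disc x y ->
  pdx (fun u v => f u v + g u v) x y = pdx f x y + pdx g x y.
Proof.
intros Hf Hg H; exact (Derive_plus (fun t => f t y) (fun t => g t y) x
  (smooth2_ex_x Hf H) (smooth2_ex_x Hg H)).
Qed.

Lemma pdy_plus f g x y : smooth2 f -> smooth2 g -> in_disc x y ->
  pdy (fun u v => f u v + g u v) x y = pdy f x y + pdy g x y.
Proof.
intros Hf Hg H; exact (Derive_plus (fun t => f x t) (fun t => g x t) y
  (smooth2_ex_y Hf H) (smooth2_ex_y Hg H)).
Qed.

Lemma pdx_minus f g x y : smooth2 f -> smooth2 g -> in_disc x y ->
  pdx (fun u v => f u v - g u v) x y = pdx f x y - pdx g x y.
Proof.
intros Hf Hg H; exact (Derive_minus (fun t => f t y) (fun t => g t y) x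
  (smooth2_ex_x Hf H) (smooth2_ex_x Hg H)).
Qed.

Lemma pdy_minus f g x y : smooth2 f -> smooth2 g -> in_disc x y ->
  pdy (fun u v => f u v - g u v) x y = pdy f x y - pdy g x y.
Proof.
intros Hf Hg H; exact (Derive_minus (fun t => f x t) (fun t => g x t) y
  (smooth2_ex_y Hf H) (smooth2_ex_y Hg H)).
Qed.

Lemma pdx_mult f g x y : smooth2 f -> smooth2 g -> in_disc x y ->
  pdx (fun u v => f u v * g u v) x y = pdx f x y * g x y + f x y * pdx g x y.
Proof.
intros Hf Hg H; exact (Derive_mult (fun t => f t y) (fun t => g t y) x
  (smooth2_ex_x Hf H) (smooth2_ex_x Hg H)).
Qed.

Lemma pdy_mult f g x y : smooth2 f -> smooth2 g -> in_disc x y ->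
  pdy (fun u v => f u v * g u v) x y = pdy f x y * g x y + f x y * pdy g x y.
Proof.
intros Hf Hg H; exact (Derive_mult (fun t => f x t) (fun t => g x t) y
  (smooth2_ex_y Hf H) (smooth2_ex_y Hg H)).
Qed.

Lemma pdx_scal (c : R) f x y : pdx (fun u v => c * f u v) x y = c * pdx f x y.
Proof. exact (Derive_scal (fun t => f t y) c x). Qed.

Lemma pdy_scal (c : R) f x y : pdy (fun u v => c * f u v) x y = c * pdy f x y.
Proof. exact (Derive_scal (fun t => f x t) c y). Qed.

Lemma pd_comm f x y : smooth2 f -> in_disc x y -> pdx (pdy f) x y = pdy (pdx f) x y.
Proof.
intros Hf H; apply (Schwarz f).
- apply (disc_loc H); intros u v Huv.
  split; [exact (smooth2_ex_x Hf Huv)|split; [exact (smooth2_ex_y Hf Huv)|]].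
  split; [exact (smooth2_ex_x (smooth2_pdy Hf) Huv)
         |exact (smooth2_ex_y (smooth2_pdx Hf) Huv)].
- exact (smooth2_cont (smooth2_pdx (smooth2_pdy Hf)) H).
- exact (smooth2_cont (smooth2_pdy (smooth2_pdx Hf)) H).
Qed.

(* The derivative of [f] along the vector field [a d/dx + b d/dy]. *)
Definition along (a b f : R -> R -> R) : R -> R -> R :=
  fun x y => a x y * pdx f x y + b x y * pdy f x y.

(* A component [V(W_i) - W(V_i)] of the commutator [[V, W]], where [a], [b] are
   the components of [V], [c], [d] those of [W], [f = V_i] and [g = W_i]. *)
Definition commutator (a b f c d g : R -> R -> R) : R -> R -> R :=
  fun x y => along a b g x y - along c d f x y.

Lemma smooth2_along a b f : smooth2 a -> smooth2 b -> smooth2 f -> smooth2 (along a b f).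
Proof.
intros Ha Hb Hf; exact (smooth2_plus (smooth2_mult Ha (smooth2_pdx Hf))
  (smooth2_mult Hb (smooth2_pdy Hf))).
Qed.

Lemma smooth2_commutator a b f c d g :
  smooth2 a -> smooth2 b -> smooth2 f -> smooth2 c -> smooth2 d -> smooth2 g ->
  smooth2 (commutator a b f c d g).
Proof.
intros Ha Hb Hf Hc Hd Hg.
exact (smooth2_minus (smooth2_along Ha Hb Hg) (smooth2_along Hc Hd Hf)).
Qed.

Lemma pdx_along a b f x y :
  smooth2 a -> smooth2 b -> smooth2 f -> in_disc x y ->
  pdx (along a b f) x y =
    pdx a x y * pdx f x y + a x y * pdx (pdx f) x y
    + (pdx b x y * pdy f x y + b x y * pdy (pdx f) x y).
Proof.
intros Ha Hb Hf H.
pose proof (smooth2_pdx Hf) as Hfx; pose proof (smooth2_pdy Hf) as Hfy.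
rewrite <- (pd_comm Hf H), <- (pdx_mult Ha Hfx H), <- (pdx_mult Hb Hfy H).
exact (pdx_plus (smooth2_mult Ha Hfx) (smooth2_mult Hb Hfy) H).
Qed.

Lemma pdy_along a b f x y :
  smooth2 a -> smooth2 b -> smooth2 f -> in_disc x y ->
  pdy (along a b f) x y =
    pdy a x y * pdx f x y + a x y * pdy (pdx f) x y
    + (pdy b x y * pdy f x y + b x y * pdy (pdy f) x y).
Proof.
intros Ha Hb Hf H.
pose proof (smooth2_pdx Hf) as Hfx; pose proof (smooth2_pdy Hf) as Hfy.
rewrite <- (pdy_mult Ha Hfx H), <- (pdy_mult Hb Hfy H).
exact (pdy_plus (smooth2_mult Ha Hfx) (smooth2_mult Hb Hfy) H).
Qed.

Lemma pdx_commutator a b f c d g x y :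
  smooth2 a -> smooth2 b -> smooth2 f -> smooth2 c -> smooth2 d -> smooth2 g ->
  in_disc x y ->
  pdx (commutator a b f c d g) x y = pdx (along a b g) x y - pdx (along c d f) x y.
Proof.
intros Ha Hb Hf Hc Hd Hg H.
exact (pdx_minus (smooth2_along Ha Hb Hg) (smooth2_along Hc Hd Hf) H).
Qed.

Lemma pdy_commutator a b f c d g x y :
  smooth2 a -> smooth2 b -> smooth2 f -> smooth2 c -> smooth2 d -> smooth2 g ->
  in_disc x y ->
  pdy (commutator a b f c d g) x y = pdy (along a b g) x y - pdy (along c d f) x y.
Proof.
intros Ha Hb Hf Hc Hd Hg H.
exact (pdy_minus (smooth2_along Ha Hb Hg) (smooth2_along Hc Hd Hf) H).
Qed.

Lemma commutator_jacobi a1 b1 f1 a2 b2 f2 a3 b3 f3 x y :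
  smooth2 a1 -> smooth2 b1 -> smooth2 f1 ->
  smooth2 a2 -> smooth2 b2 -> smooth2 f2 ->
  smooth2 a3 -> smooth2 b3 -> smooth2 f3 -> in_disc x y ->
  commutator a1 b1 f1 (commutator a2 b2 a2 a3 b3 a3) (commutator a2 b2 b2 a3 b3 b3)
    (commutator a2 b2 f2 a3 b3 f3) x y
  + (commutator a2 b2 f2 (commutator a3 b3 a3 a1 b1 a1) (commutator a3 b3 b3 a1 b1 b1)
      (commutator a3 b3 f3 a1 b1 f1) x y
  + commutator a3 b3 f3 (commutator a1 b1 a1 a2 b2 a2) (commutator a1 b1 b1 a2 b2 b2)
      (commutator a1 b1 f1 a2 b2 f2) x y) = 0.
Proof.
intros Ha1 Hb1 Hf1 Ha2 Hb2 Hf2 Ha3 Hb3 Hf3 H.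
unfold commutator at 1 5 9; unfold along.
rewrite !pdx_commutator, !pdy_commutator by assumption.
rewrite !pdx_along, !pdy_along by assumption.
unfold commutator, along; ring.
Qed.

(* A field on the open disc is represented by the pair of its two Cartesian
   components, extended by 0 to the plane: this extension is part of
   [disc_fields], so that Leibniz equality is equality of fields on the disc. *)
Definition plane_fields : ModuleSpace R_Ring :=
  prod_ModuleSpace R_Ring (fct_ModuleSpace R (fct_ModuleSpace R R_space))
    (fct_ModuleSpace R (fct_ModuleSpace R R_space)).

Definition disc_fields : subspace plane_fields.
Proof.
refine (@Build_subspace plane_fields
  (fun V : (R -> R -> R) * (R -> R -> R) =>
     smooth2 (fst V) /\ smooth2 (snd V) /\
     forall x y, ~ in_disc x y -> fst V x y = 0 /\ snd V x y = 0) _ _ _).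
- split; [exact (smooth2_const 0)|split; [exact (smooth2_const 0)|easy]].
- intros V W [comp_x [comp_y V0]] [W1 [W2 W0]].
  split; [exact (smooth2_plus comp_x W1)|split; [exact (smooth2_plus comp_y W2)|]].
  intros x y H; destruct (V0 x y H) as [v1 v2], (W0 x y H) as [w1 w2].
  split.
  + transitivity (0 + 0); [exact (f_equal2 Rplus v1 w1)|ring].
  + transitivity (0 + 0); [exact (f_equal2 Rplus v2 w2)|ring].
- intros c V [comp_x [comp_y V0]].
  split; [exact (smooth2_scal c comp_x)|split; [exact (smooth2_scal c comp_y)|]].
  intros x y H; destruct (V0 x y H) as [v1 v2].
  split.
  + transitivity (c * 0); [exact (f_equal (Rmult c) v1)|ring].
  + transitivity (c * 0); [exact (f_equal (Rmult c) v2)|ring].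
Defined.

Definition disc_space : ModuleSpace R_Ring := sub_ModuleSpace disc_fields.

Definition comp_x (V : disc_space) : R -> R -> R := fst (proj1_sig V).
Definition comp_y (V : disc_space) : R -> R -> R := snd (proj1_sig V).

Lemma comp_x_smooth V : smooth2 (comp_x V).
Proof. exact (proj1 (proj2_sig V)). Qed.

Lemma comp_y_smooth V : smooth2 (comp_y V).
Proof. exact (proj1 (proj2 (proj2_sig V))). Qed.

Lemma comp_x_out V x y : ~ in_disc x y -> comp_x V x y = 0.
Proof. intros H; exact (proj1 (proj2 (proj2 (proj2_sig V)) x y H)). Qed.

Lemma comp_y_out V x y : ~ in_disc x y -> comp_y V x y = 0.
Proof. intros H; exact (proj2 (proj2 (proj2 (proj2_sig V)) x y H)). Qed.

Lemma disc_ext (V W : disc_space) :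
  (forall x y, in_disc x y -> comp_x V x y = comp_x W x y) ->
  (forall x y, in_disc x y -> comp_y V x y = comp_y W x y) -> V = W.
Proof.
intros H1 H2; apply sig_ext; apply pair_eq;
  apply functional_extensionality; intros x; apply functional_extensionality; intros y;
  destruct (classic (in_disc x y)) as [H|H].
- now apply H1.
- change (comp_x V x y = comp_x W x y); now rewrite !comp_x_out.
- now apply H2.
- change (comp_y V x y = comp_y W x y); now rewrite !comp_y_out.
Qed.

(* Off the disc [V] and [W] vanish, hence so does this formula, whatever the
   value of [Derive] there. *)
Definition disc_bracket (V W : disc_space) : disc_space.
Proof.
refine (exist _ (commutator (comp_x V) (comp_y V) (comp_x V) (comp_x W) (comp_y W) (comp_x W),
                 commutator (comp_x V) (comp_y V) (comp_y V) (comp_x W) (comp_y W) (comp_y W)) _).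
split; [|split].
- apply smooth2_commutator; first [apply comp_x_smooth|apply comp_y_smooth].
- apply smooth2_commutator; first [apply comp_x_smooth|apply comp_y_smooth].
- intros x y H; simpl; unfold commutator, along.
  rewrite !(comp_x_out _ H), !(comp_y_out _ H); split; ring.
Defined.

Lemma comp_x_plus V W x y : comp_x (plus V W) x y = comp_x V x y + comp_x W x y.
Proof. reflexivity. Qed.
Lemma comp_y_plus V W x y : comp_y (plus V W) x y = comp_y V x y + comp_y W x y.
Proof. reflexivity. Qed.
Lemma comp_x_scal (c : R) V x y : comp_x (scal c V) x y = c * comp_x V x y.
Proof. reflexivity. Qed.
Lemma comp_y_scal (c : R) V x y : comp_y (scal c V) x y = c * comp_y V x y.
Proof. reflexivity. Qed.
Lemma comp_x_zero x y : comp_x zero x y = 0.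
Proof. reflexivity. Qed.
Lemma comp_y_zero x y : comp_y zero x y = 0.
Proof. reflexivity. Qed.
Lemma comp_x_bracket V W : comp_x (disc_bracket V W) =
  commutator (comp_x V) (comp_y V) (comp_x V) (comp_x W) (comp_y W) (comp_x W).
Proof. reflexivity. Qed.
Lemma comp_y_bracket V W : comp_y (disc_bracket V W) =
  commutator (comp_x V) (comp_y V) (comp_y V) (comp_x W) (comp_y W) (comp_y W).
Proof. reflexivity. Qed.

Lemma pdx_comp_x_plus V W x y : in_disc x y ->
  pdx (comp_x (plus V W)) x y = pdx (comp_x V) x y + pdx (comp_x W) x y.
Proof. exact (pdx_plus (comp_x_smooth V) (comp_x_smooth W)). Qed.
Lemma pdy_comp_x_plus V W x y : in_disc x y ->
  pdy (comp_x (plus V W)) x y = pdy (comp_x V) x y + pdy (comp_x W) x y.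
Proof. exact (pdy_plus (comp_x_smooth V) (comp_x_smooth W)). Qed.
Lemma pdx_comp_y_plus V W x y : in_disc x y ->
  pdx (comp_y (plus V W)) x y = pdx (comp_y V) x y + pdx (comp_y W) x y.
Proof. exact (pdx_plus (comp_y_smooth V) (comp_y_smooth W)). Qed.
Lemma pdy_comp_y_plus V W x y : in_disc x y ->
  pdy (comp_y (plus V W)) x y = pdy (comp_y V) x y + pdy (comp_y W) x y.
Proof. exact (pdy_plus (comp_y_smooth V) (comp_y_smooth W)). Qed.
Lemma pdx_comp_x_scal (c : R) V x y : pdx (comp_x (scal c V)) x y = c * pdx (comp_x V) x y.
Proof. exact (pdx_scal c (comp_x V) x y). Qed.
Lemma pdy_comp_x_scal (c : R) V x y : pdy (comp_x (scal c V)) x y = c * pdy (comp_x V) x y.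
Proof. exact (pdy_scal c (comp_x V) x y). Qed.
Lemma pdx_comp_y_scal (c : R) V x y : pdx (comp_y (scal c V)) x y = c * pdx (comp_y V) x y.
Proof. exact (pdx_scal c (comp_y V) x y). Qed.
Lemma pdy_comp_y_scal (c : R) V x y : pdy (comp_y (scal c V)) x y = c * pdy (comp_y V) x y.
Proof. exact (pdy_scal c (comp_y V) x y). Qed.

Opaque comp_x comp_y disc_bracket.

Definition GVect : LieAlgebra.
Proof.
refine (@Build_LieAlgebra disc_space disc_bracket _ _ _ _ _ _).
1-5: intros; apply disc_ext; intros u v Huv;
  repeat rewrite ?comp_x_plus, ?comp_y_plus, ?comp_x_scal, ?comp_y_scal, ?comp_x_zero, ?comp_y_zero,
    ?comp_x_bracket, ?comp_y_bracket; unfold commutator, along;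
  rewrite ?comp_x_plus, ?comp_y_plus, ?comp_x_scal, ?comp_y_scal,
    ?(pdx_comp_x_plus _ _ Huv), ?(pdx_comp_y_plus _ _ Huv), ?(pdy_comp_x_plus _ _ Huv),
    ?(pdy_comp_y_plus _ _ Huv), ?pdx_comp_x_scal, ?pdy_comp_x_scal, ?pdx_comp_y_scal, ?pdy_comp_y_scal;
  ring.
intros U V W; apply disc_ext; intros x y H;
  rewrite !comp_x_plus, ?comp_y_plus, ?comp_x_zero, ?comp_y_zero, ?comp_x_bracket, ?comp_y_bracket
  || rewrite !comp_y_plus, ?comp_x_zero, ?comp_y_zero, ?comp_x_bracket, ?comp_y_bracket;
  apply commutator_jacobi; first [exact H|apply comp_x_smooth|apply comp_y_smooth].
Defined.

Transparent comp_x comp_y disc_bracket.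

(* [V = V3 d/dr + V4 d/dtheta], where [d/dr = cos t d/dx + sin t d/dy] and
   [d/dtheta = - r sin t d/dx + r cos t d/dy]. *)
Definition comp_r (V : disc_space) (r t : R) : R :=
  cos t * comp_x V (r * cos t) (r * sin t) + sin t * comp_y V (r * cos t) (r * sin t).
Definition comp_theta (V : disc_space) (r t : R) : R :=
  (cos t * comp_y V (r * cos t) (r * sin t) - sin t * comp_x V (r * cos t) (r * sin t)) / r.

(* [P] holds, in polar coordinates, on the points of the open disc that lie in
   some neighborhood of the unit circle.  Fields are not defined on the circle
   itself, and polar coordinates are not defined at the origin. *)
Definition near_circle (P : R -> R -> Prop) : Prop :=
  exists O : R * R -> Prop,
    open O /\ (forall x y, x ^ 2 + y ^ 2 = 1 -> O (x, y)) /\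
    forall r t, 0 < r < 1 -> O (r * cos t, r * sin t) -> P r t.

Definition closed_disc (p : R * R) : Prop := fst p ^ 2 + snd p ^ 2 <= 1.

Definition extends_continuously (f : R -> R -> R) : Prop :=
  exists g : R * R -> R,
    continuous_on closed_disc g /\ forall x y, in_disc x y -> g (x, y) = f x y.

Definition radially_constant (V : disc_space) : Prop :=
  near_circle (fun r t =>
    is_derive (fun s => comp_r V s t) r 0 /\ is_derive (fun s => comp_theta V s t) r 0).

Definition asymptotically_zero (V : disc_space) : Prop :=
  near_circle (fun r t => comp_r V r t = 0 /\ comp_theta V r t = 0).

Lemma cos2_sin2 t : cos t ^ 2 + sin t ^ 2 = 1.
Proof. pose proof (sin2_cos2 t) as H; unfold Rsqr in H; lra. Qed.

Lemma polar_exists u w : u ^ 2 + w ^ 2 = 1 ->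
  exists t, - PI <= t <= PI /\ cos t = u /\ sin t = w.
Proof.
intros H.
assert (Hu : -1 <= u <= 1) by nra.
pose proof (acos_bound u) as [B1 B2].
assert (S : sin (acos u) = Rabs w).
{ rewrite sin_acos by exact Hu; rewrite <- sqrt_Rsqr_abs; f_equal; unfold Rsqr; lra. }
destruct (Rle_dec 0 w) as [Hw|Hw].
- exists (acos u); split; [lra|split; [now apply cos_acos|]].
  rewrite S; now apply Rabs_pos_eq.
- exists (- acos u); split; [lra|split; [now rewrite cos_neg; apply cos_acos|]].
  rewrite sin_neg, S, Rabs_left; lra.
Qed.

Lemma lip_1 (f df : R -> R) a b :
  (forall x, is_derive f x (df x)) -> (forall x, Rabs (df x) <= 1) ->
  Rabs (f b - f a) <= Rabs (b - a).
Proof.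
intros Hf Hd.
destruct (MVT_gen f a b df) as [c [_ Hc]].
- intros x _; apply Hf.
- intros x _; apply continuity_pt_filterlim; apply (ex_derive_continuous f).
  eexists; apply Hf.
- rewrite Hc, Rabs_mult; rewrite <- (Rmult_1_l (Rabs (b - a))) at 2.
  apply Rmult_le_compat_r; [apply Rabs_pos|apply Hd].
Qed.

Lemma cos_lip a b : Rabs (cos b - cos a) <= Rabs (b - a).
Proof.
apply (lip_1 (df := fun x => - sin x)); [intros x; apply is_derive_cos|].
intros x; rewrite Rabs_Ropp; apply Rabs_le; pose proof (SIN_bound x); lra.
Qed.

Lemma sin_lip a b : Rabs (sin b - sin a) <= Rabs (b - a).
Proof.
apply (lip_1 (df := cos)); [intros x; apply is_derive_sin|].
intros x; apply Rabs_le; pose proof (COS_bound x); lra.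
Qed.

Lemma in_disc_polar r t : -1 < r < 1 -> in_disc (r * cos t) (r * sin t).
Proof.
intros Hr; unfold in_disc.
replace ((r * cos t) ^ 2 + (r * sin t) ^ 2) with (r ^ 2 * (cos t ^ 2 + sin t ^ 2)) by ring.
rewrite cos2_sin2; nra.
Qed.

Lemma near_circle_annulus P : near_circle P <->
  exists d, 0 < d < 1 /\ forall r t, 1 - d < r < 1 -> P r t.
Proof.
split.
- intros [O [Oo [Oc OP]]].
  assert (H : forall t, exists e : posreal, forall x y,
    Rabs (x - cos t) < e -> Rabs (y - sin t) < e -> O (x, y)).
  { intros t; destruct (Oo (cos t, sin t)) as [e He].
    - apply Oc, cos2_sin2.
    - exists e; intros x y Hx Hy; apply He; split; assumption. }
  pose (e t := proj1_sig (constructive_indefinite_description _ (H t))).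
  assert (He : forall t x y, Rabs (x - cos t) < e t -> Rabs (y - sin t) < e t -> O (x, y)).
  { intros t; unfold e.
    now destruct (constructive_indefinite_description _ (H t)). }
  destruct (compactness_value_1d (- PI) PI (fun t => pos_div_2 (e t))) as [d Hd].
  exists (Rmin d (1 / 2)); split.
  { split; [apply Rmin_pos; [apply cond_pos|lra]|].
    apply Rle_lt_trans with (1 / 2); [apply Rmin_r|lra]. }
  intros r t Hr.
  pose proof (Rmin_l d (1 / 2)) as m1; pose proof (Rmin_r d (1 / 2)) as m2.
  apply OP; [lra|].
  destruct (@polar_exists (cos t) (sin t) (cos2_sin2 t)) as [s [Hs [<- <-]]].
  apply NNPP; intros N; apply (Hd s Hs); intros [u [_ [Hu1 Hu2]]]; apply N.
  simpl in Hu1, Hu2.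
  pose proof (cos_lip u s) as Lc; pose proof (sin_lip u s) as Ls.
  assert (A : forall c c0, -1 <= c <= 1 -> Rabs (c - c0) <= Rabs (s - u) ->
    Rabs (r * c - c0) < e u).
  { intros c c0 Hc L.
    replace (r * c - c0) with ((c - c0) - (1 - r) * c) by ring.
    apply Rle_lt_trans with (1 := Rabs_triang _ _).
    rewrite Rabs_Ropp, Rabs_mult, (Rabs_pos_eq (1 - r)) by lra.
    assert (Rabs c <= 1) by (apply Rabs_le; lra).
    assert ((1 - r) * Rabs c <= 1 - r) by nra.
    lra. }
  apply (He u); apply A; auto using COS_bound, SIN_bound.
- intros [d [Hd HP]].
  exists (fun p => (1 - d) ^ 2 < fst p ^ 2 + snd p ^ 2); split; [|split].
  + intros [x y] H; simpl fst in H; simpl snd in H.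
    apply locally_2d_locally with (P := fun u v => (1 - d) ^ 2 < u ^ 2 + v ^ 2).
    assert (C : continuity_2d_pt (fun u v => u * u + v * v) x y).
    { apply continuity_2d_pt_plus; apply continuity_2d_pt_mult;
        first [apply continuity_2d_pt_id1|apply continuity_2d_pt_id2]. }
    assert (e0 : 0 < x ^ 2 + y ^ 2 - (1 - d) ^ 2) by lra.
    destruct (C (mkposreal _ e0)) as [e He]; exists e; intros u v Hu Hv.
    specialize (He u v Hu Hv); simpl in He; apply Rabs_def2 in He; nra.
  + intros x y H; simpl; nra.
  + intros r t Hr H; apply HP; simpl fst in H; simpl snd in H.
    replace ((r * cos t) ^ 2 + (r * sin t) ^ 2) with (r ^ 2 * (cos t ^ 2 + sin t ^ 2))
      in H by ring.
    rewrite cos2_sin2 in H; nra.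
Qed.

Lemma smooth2_differentiable f x y : smooth2 f -> in_disc x y ->
  differentiable_pt_lim f x y (pdx f x y) (pdy f x y).
Proof.
intros Hf H; apply filterdiff_differentiable_pt_lim.
apply (is_derive_filterdiff f x y (pdx f) (pdy f x y)).
- apply locally_2d_locally with (P := fun u v => is_derive (fun z => f z v) u (pdx f u v)).
  apply (disc_loc H); intros u v Huv; apply Derive_correct; now apply smooth2_ex_x.
- apply Derive_correct; now apply smooth2_ex_y.
- apply continuity_2d_pt_filterlim; now apply smooth2_cont; [apply smooth2_pdx|].
Qed.

Lemma is_derive_radial f r t : smooth2 f -> -1 < r < 1 ->
  is_derive (fun s => f (s * cos t) (s * sin t)) r
    (pdx f (r * cos t) (r * sin t) * cos t + pdy f (r * cos t) (r * sin t) * sin t).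
Proof.
intros Hf Hr; apply is_derive_Reals.
apply (derivable_pt_lim_comp_2d f (fun s => s * cos t) (fun s => s * sin t)).
- apply smooth2_differentiable; [exact Hf|now apply in_disc_polar].
- apply is_derive_Reals; auto_derive; [easy|ring].
- apply is_derive_Reals; auto_derive; [easy|ring].
Qed.

Lemma is_derive_angular f r t : smooth2 f -> -1 < r < 1 ->
  is_derive (fun s => f (r * cos s) (r * sin s)) t
    (pdx f (r * cos t) (r * sin t) * (- r * sin t)
     + pdy f (r * cos t) (r * sin t) * (r * cos t)).
Proof.
intros Hf Hr; apply is_derive_Reals.
apply (derivable_pt_lim_comp_2d f (fun s => r * cos s) (fun s => r * sin s)).
- apply smooth2_differentiable; [exact Hf|now apply in_disc_polar].
- apply is_derive_Reals; auto_derive; [easy|ring].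
- apply is_derive_Reals; auto_derive; [easy|ring].
Qed.

(* [a], [b] are the Cartesian components, as functions of the polar
   coordinates. *)
Section PolarDerivatives.
Variables (a b : R -> R -> R) (r t : R).
Hypotheses (Ha : smooth2 a) (Hb : smooth2 b) (Hr : 0 < r < 1).
Let ar := pdx a (r * cos t) (r * sin t) * cos t + pdy a (r * cos t) (r * sin t) * sin t.
Let br := pdx b (r * cos t) (r * sin t) * cos t + pdy b (r * cos t) (r * sin t) * sin t.
Let at_ := pdx a (r * cos t) (r * sin t) * (- r * sin t)
  + pdy a (r * cos t) (r * sin t) * (r * cos t).
Let bt := pdx b (r * cos t) (r * sin t) * (- r * sin t)
  + pdy b (r * cos t) (r * sin t) * (r * cos t).
Let a0 := a (r * cos t) (r * sin t).
Let b0 := b (r * cos t) (r * sin t).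

Lemma is_derive_r_r :
  is_derive (fun s => cos t * a (s * cos t) (s * sin t) + sin t * b (s * cos t) (s * sin t))
    r (cos t * ar + sin t * br).
Proof.
assert (Hr' : -1 < r < 1) by lra.
exact (is_derive_plus _ _ r _ _
  (is_derive_scal _ r (cos t) _ (is_derive_radial t Ha Hr'))
  (is_derive_scal _ r (sin t) _ (is_derive_radial t Hb Hr'))).
Qed.

Lemma is_derive_theta_r :
  is_derive
    (fun s => (cos t * b (s * cos t) (s * sin t) - sin t * a (s * cos t) (s * sin t)) / s)
    r (((cos t * br - sin t * ar) * r - (cos t * b0 - sin t * a0)) / r ^ 2).
Proof.
assert (Hr' : -1 < r < 1) by lra.
assert (D : is_derive
  (fun s => cos t * b (s * cos t) (s * sin t) - sin t * a (s * cos t) (s * sin t))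
  r (cos t * br - sin t * ar)).
{ exact (is_derive_minus _ _ r _ _
  (is_derive_scal _ r (cos t) _ (is_derive_radial t Hb Hr'))
  (is_derive_scal _ r (sin t) _ (is_derive_radial t Ha Hr'))). }
assert (r0 : r <> 0) by lra.
pose proof (is_derive_div _ (fun s => s) r _ 1 D (is_derive_id r) r0) as H.
simpl in H.
replace (((cos t * br - sin t * ar) * r - (cos t * b0 - sin t * a0)) / r ^ 2)
  with (((cos t * br - sin t * ar) * r
     - (cos t * b (r * cos t) (r * sin t) - sin t * a (r * cos t) (r * sin t)) * 1) / r ^ 2)
  by (unfold a0, b0; field; exact r0).
exact H.
Qed.

Lemma is_derive_r_t :
  is_derive (fun s => cos s * a (r * cos s) (r * sin s) + sin s * b (r * cos s) (r * sin s))
    t (- sin t * a0 + cos t * at_ + (cos t * b0 + sin t * bt)).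
Proof.
assert (Hr' : -1 < r < 1) by lra.
exact (is_derive_plus _ _ t _ _
  (is_derive_mult cos _ t _ _ (is_derive_cos t) (is_derive_angular t Ha Hr') Rmult_comm)
  (is_derive_mult sin _ t _ _ (is_derive_sin t) (is_derive_angular t Hb Hr') Rmult_comm)).
Qed.

Lemma is_derive_theta_t :
  is_derive
    (fun s => (cos s * b (r * cos s) (r * sin s) - sin s * a (r * cos s) (r * sin s)) / r)
    t ((- sin t * b0 + cos t * bt - (cos t * a0 + sin t * at_)) / r).
Proof.
assert (Hr' : -1 < r < 1) by lra.
assert (D := is_derive_minus _ _ t _ _
  (is_derive_mult cos _ t _ _ (is_derive_cos t) (is_derive_angular t Hb Hr') Rmult_comm)
  (is_derive_mult sin _ t _ _ (is_derive_sin t) (is_derive_angular t Ha Hr') Rmult_comm)).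
assert (r0 : r <> 0) by lra.
apply (is_derive_ext (fun s => / r *
  (cos s * b (r * cos s) (r * sin s) - sin s * a (r * cos s) (r * sin s)))).
{ intros s; unfold Rdiv; apply Rmult_comm. }
unfold Rdiv; rewrite (Rmult_comm _ (/ r)).
exact (is_derive_scal _ t (/ r) _ D).
Qed.
End PolarDerivatives.

Lemma rotate c s u w : c ^ 2 + s ^ 2 = 1 ->
  exists p q, u = c * p - s * q /\ w = s * p + c * q.
Proof.
intros H; exists (c * u + s * w), (c * w - s * u); split.
- transitivity (u * (c ^ 2 + s ^ 2)); [rewrite H|]; ring.
- transitivity (w * (c ^ 2 + s ^ 2)); [rewrite H|]; ring.
Qed.

Lemma comp_bracket_algebra (r c s v1x v1y v2x v2y w1x w1y w2x w2y v1 v2 w1 w2 : R) :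
  r <> 0 -> c ^ 2 + s ^ 2 = 1 ->
  c * (v1x * c + v1y * s) + s * (v2x * c + v2y * s) = 0 ->
  ((c * (v2x * c + v2y * s) - s * (v1x * c + v1y * s)) * r - (c * v2 - s * v1)) / r ^ 2 = 0 ->
  c * (w1x * c + w1y * s) + s * (w2x * c + w2y * s) = 0 ->
  ((c * (w2x * c + w2y * s) - s * (w1x * c + w1y * s)) * r - (c * w2 - s * w1)) / r ^ 2 = 0 ->
  let b1 := v1 * w1x + v2 * w1y - (w1 * v1x + w2 * v1y) in
  let b2 := v1 * w2x + v2 * w2y - (w1 * v2x + w2 * v2y) in
  let q := (c * v2 - s * v1) / r in
  let q' := (c * w2 - s * w1) / r in
  let at_ := v1x * (- r * s) + v1y * (r * c) in
  let bt := v2x * (- r * s) + v2y * (r * c) in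
  let at' := w1x * (- r * s) + w1y * (r * c) in
  let bt' := w2x * (- r * s) + w2y * (r * c) in
  c * b1 + s * b2 = q * (- s * w1 + c * at' + (c * w2 + s * bt'))
    - q' * (- s * v1 + c * at_ + (c * v2 + s * bt)) /\
  (c * b2 - s * b1) / r = q * ((- s * w2 + c * bt' - (c * w1 + s * at')) / r)
    - q' * ((- s * v2 + c * bt - (c * v1 + s * at_)) / r).
Proof.
intros r0 CS v3 v4 w3 w4.
destruct (rotate v1 v2 CS) as [p [q [-> ->]]].
destruct (rotate w1 w2 CS) as [p' [q' [-> ->]]].
destruct (rotate v1x v1y CS) as [A [T1 [-> ->]]].
destruct (rotate v2x v2y CS) as [B [T2 [-> ->]]].
destruct (rotate w1x w1y CS) as [A' [T1' [-> ->]]].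
destruct (rotate w2x w2y CS) as [B' [T2' [-> ->]]].
destruct (rotate A B CS) as [a [b [-> ->]]].
destruct (rotate A' B' CS) as [a' [b' [-> ->]]].
assert (CS' : c * c = 1 - s * s) by lra.
assert (a0 : a = 0) by (rewrite <- v3; ring [CS']).
assert (a0' : a' = 0) by (rewrite <- w3; ring [CS']).
assert (Hb : b = q / r).
{ assert (e : b * r - q = 0).
  { match type of v4 with ?X = 0 => transitivity (X * r ^ 2) end;
      [field [CS']; exact r0|rewrite v4; ring]. }
  apply (Rmult_eq_reg_r r); [field_simplify; [lra|exact r0]|exact r0]. }
assert (Hb' : b' = q' / r).
{ assert (e : b' * r - q' = 0).
  { match type of w4 with ?X = 0 => transitivity (X * r ^ 2) end;
      [field [CS']; exact r0|rewrite w4; ring]. }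
  apply (Rmult_eq_reg_r r); [field_simplify; [lra|exact r0]|exact r0]. }
subst a a' b b'; simpl; split; field [CS']; exact r0.
Qed.

(* In polar coordinates, where the components do not depend on [r], the
   commutator only involves the angular derivatives. *)
Lemma comp_bracket V W r t : 0 < r < 1 ->
  is_derive (fun s => comp_r V s t) r 0 -> is_derive (fun s => comp_theta V s t) r 0 ->
  is_derive (fun s => comp_r W s t) r 0 -> is_derive (fun s => comp_theta W s t) r 0 ->
  comp_r (disc_bracket V W) r t =
    comp_theta V r t * Derive (comp_r W r) t - comp_theta W r t * Derive (comp_r V r) t /\
  comp_theta (disc_bracket V W) r t =
    comp_theta V r t * Derive (comp_theta W r) t
    - comp_theta W r t * Derive (comp_theta V r) t.
Proof.
intros Hr v3 v4 w3 w4.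
pose proof (comp_x_smooth V) as sv1; pose proof (comp_y_smooth V) as sv2.
pose proof (comp_x_smooth W) as sw1; pose proof (comp_y_smooth W) as sw2.
rewrite (is_derive_unique (comp_r V r) _ _ (is_derive_r_t t sv1 sv2 Hr)).
rewrite (is_derive_unique (comp_theta V r) _ _ (is_derive_theta_t t sv1 sv2 Hr)).
rewrite (is_derive_unique (comp_r W r) _ _ (is_derive_r_t t sw1 sw2 Hr)).
rewrite (is_derive_unique (comp_theta W r) _ _ (is_derive_theta_t t sw1 sw2 Hr)).
apply is_derive_unique in v3, w3, v4, w4.
rewrite (is_derive_unique (fun s => comp_r V s t) _ _ (is_derive_r_r t sv1 sv2 Hr)) in v3.
rewrite (is_derive_unique (fun s => comp_r W s t) _ _ (is_derive_r_r t sw1 sw2 Hr)) in w3.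
rewrite (is_derive_unique (fun s => comp_theta V s t) _ _ (is_derive_theta_r t sv1 sv2 Hr)) in v4.
rewrite (is_derive_unique (fun s => comp_theta W s t) _ _ (is_derive_theta_r t sw1 sw2 Hr)) in w4.
assert (r0 : r <> 0) by lra.
exact (comp_bracket_algebra r0 (cos2_sin2 t) v3 v4 w3 w4).
Qed.

Lemma locally_annulus (P : R -> Prop) a b r :
  a < r < b -> (forall s, a < s < b -> P s) -> locally r P.
Proof.
intros Hr HP.
assert (e0 : 0 < Rmin (r - a) (b - r)) by (apply Rmin_pos; lra).
exists (mkposreal _ e0); intros s Hs; apply HP.
apply Rabs_def2 in Hs; simpl in Hs.
pose proof (Rmin_l (r - a) (b - r)); pose proof (Rmin_r (r - a) (b - r)).
unfold minus, plus, opp in Hs; simpl in Hs; lra.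
Qed.

Lemma derive_zero_annulus (f : R -> R) a b :
  (forall r, a < r < b -> is_derive f r 0) <->
  (forall r s, a < r < b -> a < s < b -> f r = f s).
Proof.
split.
- intros H.
  assert (L : forall r s, a < r < b -> a < s < b -> r < s -> f r = f s).
  { intros r s Hr Hs rs; apply (eq_is_derive f r s); [|exact rs].
    intros u Hu; apply H; lra. }
  intros r s Hr Hs; destruct (Rtotal_order r s) as [E|[->|E]]; [now apply L|easy|].
  symmetry; apply L; [exact Hs|exact Hr|exact E].
- intros H r Hr; apply (is_derive_ext_loc (fun _ => f r)).
  + apply (locally_annulus Hr); intros s Hs; now apply H.
  + exact (is_derive_const (f r) r).
Qed.

Lemma radially_constant_annulus V : radially_constant V <->
  exists d, 0 < d < 1 /\ forall r s t, 1 - d < r < 1 -> 1 - d < s < 1 ->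
    comp_r V r t = comp_r V s t /\ comp_theta V r t = comp_theta V s t.
Proof.
unfold radially_constant; rewrite near_circle_annulus; split;
  intros [d [Hd H]]; exists d; split; try exact Hd.
- intros r s t Hr Hs; split.
  + apply (proj1 (derive_zero_annulus (fun u => comp_r V u t) (1 - d) 1)); try assumption.
    intros u Hu; exact (proj1 (H u t Hu)).
  + apply (proj1 (derive_zero_annulus (fun u => comp_theta V u t) (1 - d) 1)); try assumption.
    intros u Hu; exact (proj2 (H u t Hu)).
- intros r t Hr; split.
  + apply (proj2 (derive_zero_annulus (fun u => comp_r V u t) (1 - d) 1)); try assumption.
    intros u u' Hu Hu'; exact (proj1 (H u u' t Hu Hu')).
  + apply (proj2 (derive_zero_annulus (fun u => comp_theta V u t) (1 - d) 1)); try assumption.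
    intros u u' Hu Hu'; exact (proj2 (H u u' t Hu Hu')).
Qed.

Lemma continuity_2d_pt_comp f a b x y :
  continuity_2d_pt f (a x y) (b x y) -> continuity_2d_pt a x y ->
  continuity_2d_pt b x y -> continuity_2d_pt (fun u v => f (a u v) (b u v)) x y.
Proof.
intros Hf Ha Hb e; destruct (Hf e) as [d Hd].
destruct (Ha d) as [d1 H1], (Hb d) as [d2 H2].
assert (d0 : 0 < Rmin d1 d2) by (apply Rmin_pos; apply cond_pos).
exists (mkposreal _ d0); simpl; intros u v Hu Hv.
pose proof (Rmin_l d1 d2); pose proof (Rmin_r d1 d2).
apply Hd; [apply H1; lra|apply H2; lra].
Qed.

Lemma continuity_2d_pt_within g (D : R * R -> Prop) x y : continuity_2d_pt g x y ->
  filterlim (fun p => g (fst p) (snd p)) (within D (locally (x, y))) (locally (g x y)).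
Proof.
intros H P HP.
destruct (proj1 (continuity_2d_pt_filterlim g x y) H P HP) as [e He].
exists e; intros p Hp _; now apply He.
Qed.

Lemma extends_continuously_outer f h k :
  smooth2 f -> k < 1 ->
  (forall x y, k < x ^ 2 + y ^ 2 -> continuity_2d_pt h x y) ->
  (forall x y, in_disc x y -> k < x ^ 2 + y ^ 2 -> f x y = h x y) ->
  extends_continuously f.
Proof.
intros Hf Hk Hc Hh.
pose (g u v := if Rlt_dec (u ^ 2 + v ^ 2) 1 then f u v else h u v).
exists (fun p => g (fst p) (snd p)); split.
- intros [x y] D; unfold closed_disc in D; simpl in D.
  apply (@continuity_2d_pt_within g closed_disc x y).
  destruct (Rlt_dec (x ^ 2 + y ^ 2) 1) as [H|H].
  + apply (continuity_2d_pt_ext_loc f); [|now apply smooth2_cont].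
    apply (disc_loc H); intros u v Huv; unfold in_disc in Huv; unfold g.
    now destruct (Rlt_dec (u ^ 2 + v ^ 2) 1).
  + apply (continuity_2d_pt_ext_loc h); [|apply Hc; simpl in *; lra].
    assert (C : continuity_2d_pt (fun u v => u * u + v * v) x y).
    { apply continuity_2d_pt_plus; apply continuity_2d_pt_mult;
      first [apply continuity_2d_pt_id1|apply continuity_2d_pt_id2]. }
    assert (e0 : 0 < 1 - k) by lra.
    destruct (C (mkposreal _ e0)) as [e He]; exists e; intros u v Hu Hv.
    specialize (He u v Hu Hv); simpl in He; apply Rabs_def2 in He; unfold g.
    destruct (Rlt_dec (u ^ 2 + v ^ 2) 1) as [H'|H']; [|easy].
    symmetry; apply Hh; [exact H'|simpl in *; lra].
- intros x y H; simpl; unfold in_disc in H; unfold g.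
  destruct (Rlt_dec (x ^ 2 + y ^ 2) 1) as [H'|H']; [easy|contradiction].
Qed.

Section Extension.
Variables (V : disc_space) (d : R).
Hypothesis Hd : 0 < d < 1.
Hypothesis HV : forall r s t, 1 - d < r < 1 -> 1 - d < s < 1 ->
    comp_r V r t = comp_r V s t /\ comp_theta V r t = comp_theta V s t.
Let rho := 1 - d / 2.

Definition dir1 (x y : R) : R := x / sqrt (x ^ 2 + y ^ 2).
Definition dir2 (x y : R) : R := y / sqrt (x ^ 2 + y ^ 2).
Let a x y := comp_x V (rho * dir1 x y) (rho * dir2 x y).
Let b x y := comp_y V (rho * dir1 x y) (rho * dir2 x y).
Let v3 x y := dir1 x y * a x y + dir2 x y * b x y.
Let v4 x y := (dir1 x y * b x y - dir2 x y * a x y) * / rho.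
Let h1 x y := dir1 x y * v3 x y - y * v4 x y.
Let h2 x y := dir2 x y * v3 x y + x * v4 x y.

Lemma norm_continuous x y : 0 < x ^ 2 + y ^ 2 ->
  continuity_2d_pt (fun u v => / sqrt (u ^ 2 + v ^ 2)) x y.
Proof.
intros H; apply continuity_2d_pt_inv.
- apply (continuity_1d_2d_pt_comp sqrt (fun u v => u ^ 2 + v ^ 2)).
  + apply continuity_pt_sqrt; lra.
  + apply (continuity_2d_pt_ext (fun u v => u * u + v * v)); [intros; ring|].
    apply continuity_2d_pt_plus; apply continuity_2d_pt_mult;
      first [apply continuity_2d_pt_id1|apply continuity_2d_pt_id2].
- pose proof (sqrt_lt_R0 _ H); lra.
Qed.

Lemma dir1_continuous x y : 0 < x ^ 2 + y ^ 2 -> continuity_2d_pt dir1 x y.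
Proof.
intros H; apply continuity_2d_pt_mult; [apply continuity_2d_pt_id1|].
now apply norm_continuous.
Qed.

Lemma dir2_continuous x y : 0 < x ^ 2 + y ^ 2 -> continuity_2d_pt dir2 x y.
Proof.
intros H; apply continuity_2d_pt_mult; [apply continuity_2d_pt_id2|].
now apply norm_continuous.
Qed.

Lemma dir_norm x y : 0 < x ^ 2 + y ^ 2 -> dir1 x y ^ 2 + dir2 x y ^ 2 = 1.
Proof.
intros H; unfold dir1, dir2.
pose proof (sqrt_lt_R0 _ H) as P.
assert (S : sqrt (x ^ 2 + y ^ 2) ^ 2 = x ^ 2 + y ^ 2)
  by (rewrite pow2_sqrt; lra).
revert S P; generalize (sqrt (x ^ 2 + y ^ 2)); intros n S P.
transitivity ((x ^ 2 + y ^ 2) / n ^ 2); [|rewrite <- S]; field; lra.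
Qed.

Lemma sample_continuous f x y : smooth2 f -> 0 < x ^ 2 + y ^ 2 ->
  continuity_2d_pt (fun u v => f (rho * dir1 u v) (rho * dir2 u v)) x y.
Proof.
intros Hf H.
apply (continuity_2d_pt_comp (a := fun u v => rho * dir1 u v)
  (b := fun u v => rho * dir2 u v)).
- apply smooth2_cont; [exact Hf|]; unfold in_disc.
  rewrite !Rpow_mult_distr, <- Rmult_plus_distr_l, dir_norm by exact H.
  unfold rho; nra.
- apply continuity_2d_pt_mult; [apply continuity_2d_pt_const|now apply dir1_continuous].
- apply continuity_2d_pt_mult; [apply continuity_2d_pt_const|now apply dir2_continuous].
Qed.

Lemma v34_continuous x y : 0 < x ^ 2 + y ^ 2 ->
  continuity_2d_pt v3 x y /\ continuity_2d_pt v4 x y.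
Proof.
intros H.
pose proof (sample_continuous (comp_x_smooth V) H) as Ca.
pose proof (sample_continuous (comp_y_smooth V) H) as Cb.
pose proof (dir1_continuous H) as C1; pose proof (dir2_continuous H) as C2.
split.
- apply continuity_2d_pt_plus; now apply continuity_2d_pt_mult.
- apply continuity_2d_pt_mult; [|apply continuity_2d_pt_const].
  apply continuity_2d_pt_minus; now apply continuity_2d_pt_mult.
Qed.

Lemma h12_eq x y : in_disc x y -> (1 - d) ^ 2 < x ^ 2 + y ^ 2 ->
  comp_x V x y = h1 x y /\ comp_y V x y = h2 x y.
Proof.
intros D H; unfold in_disc in D.
assert (P : 0 < x ^ 2 + y ^ 2) by nra.
destruct (polar_exists (dir_norm P)) as [t [_ [Hc Hs]]].
set (r := sqrt (x ^ 2 + y ^ 2)).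
assert (r0 : 0 < r) by (apply sqrt_lt_R0; lra).
assert (r2 : r ^ 2 = x ^ 2 + y ^ 2) by (unfold r; rewrite pow2_sqrt; lra).
assert (Hx : x = r * cos t) by (rewrite Hc; unfold dir1; fold r; field; lra).
assert (Hy : y = r * sin t) by (rewrite Hs; unfold dir2; fold r; field; lra).
assert (Hr : 1 - d < r < 1) by nra.
assert (Hrho : 1 - d < rho < 1) by (unfold rho; lra).
destruct (HV t Hr Hrho) as [E3 E4].
assert (F3 : v3 x y = comp_r V r t)
  by (rewrite E3; unfold v3, a, b; rewrite <- Hc, <- Hs; reflexivity).
assert (F4 : v4 x y = comp_theta V r t)
  by (rewrite E4; unfold v4, a, b; rewrite <- Hc, <- Hs; reflexivity).
unfold h1, h2; rewrite F3, F4, <- Hc, <- Hs; unfold comp_r, comp_theta.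
rewrite <- Hx, <- Hy; generalize (comp_x V x y) (comp_y V x y); intros A B.
rewrite Hx, Hy.
pose proof (cos2_sin2 t) as CS.
assert (CS' : cos t * cos t = 1 - sin t * sin t) by lra.
split; field [CS']; lra.
Qed.

Lemma extends_comp_x : extends_continuously (comp_x V).
Proof.
apply (extends_continuously_outer (h := h1) (k := (1 - d) ^ 2)).
- apply comp_x_smooth.
- nra.
- intros x y H; assert (P : 0 < x ^ 2 + y ^ 2) by nra.
  destruct (v34_continuous P) as [C3 C4].
  apply continuity_2d_pt_minus; apply continuity_2d_pt_mult; try assumption.
  + now apply dir1_continuous.
  + apply continuity_2d_pt_id2.
- intros x y D H; now apply h12_eq.
Qed.

Lemma extends_comp_y : extends_continuously (comp_y V).
Proof.
apply (extends_continuously_outer (h := h2) (k := (1 - d) ^ 2)).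
- apply comp_y_smooth.
- nra.
- intros x y H; assert (P : 0 < x ^ 2 + y ^ 2) by nra.
  destruct (v34_continuous P) as [C3 C4].
  apply continuity_2d_pt_plus; apply continuity_2d_pt_mult; try assumption.
  + now apply dir2_continuous.
  + apply continuity_2d_pt_id1.
- intros x y D H; now apply h12_eq.
Qed.
End Extension.

Definition asymptotically_radial (V : disc_space) : Prop :=
  extends_continuously (comp_x V) /\ extends_continuously (comp_y V) /\
  radially_constant V.

Lemma radially_constant_ar V : radially_constant V -> asymptotically_radial V.
Proof.
intros H; destruct (proj1 (radially_constant_annulus V) H) as [d [Hd HV]].
split; [exact (extends_comp_x Hd HV)|split; [exact (extends_comp_y Hd HV)|exact H]].
Qed.

Lemma near_circle_and P Q :
  near_circle P -> near_circle Q -> near_circle (fun r t => P r t /\ Q r t).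
Proof.
rewrite !near_circle_annulus; intros [d [Hd HP]] [e [He HQ]].
pose proof (Rmin_l d e); pose proof (Rmin_r d e).
exists (Rmin d e); split; [split; [apply Rmin_pos; lra|lra]|].
intros r t Hr; split; [apply HP|apply HQ]; lra.
Qed.

Lemma near_circle_mono (P Q : R -> R -> Prop) :
  (forall r t, 0 < r < 1 -> P r t -> Q r t) -> near_circle P -> near_circle Q.
Proof.
intros H [O [Oo [Oc OP]]]; exists O; split; [exact Oo|split; [exact Oc|]].
intros r t Hr HO; apply H; auto.
Qed.

Lemma near_circle_true (P : R -> R -> Prop) : (forall r t, P r t) -> near_circle P.
Proof.
intros H; apply near_circle_annulus; exists (1 / 2); split; [lra|auto].
Qed.

Lemma comp_r_zero r t : comp_r zero r t = 0.
Proof. unfold comp_r; rewrite comp_x_zero, comp_y_zero; ring. Qed.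
Lemma comp_theta_zero r t : comp_theta zero r t = 0.
Proof. unfold comp_theta, Rdiv; rewrite comp_x_zero, comp_y_zero; ring. Qed.
Lemma comp_r_plus V W r t : comp_r (plus V W) r t = comp_r V r t + comp_r W r t.
Proof. unfold comp_r; rewrite comp_x_plus, comp_y_plus; ring. Qed.
Lemma comp_theta_plus V W r t :
  comp_theta (plus V W) r t = comp_theta V r t + comp_theta W r t.
Proof. unfold comp_theta, Rdiv; rewrite comp_x_plus, comp_y_plus; ring. Qed.
Lemma comp_r_scal (c : R) V r t : comp_r (scal c V) r t = c * comp_r V r t.
Proof. unfold comp_r; rewrite comp_x_scal, comp_y_scal; ring. Qed.
Lemma comp_theta_scal (c : R) V r t : comp_theta (scal c V) r t = c * comp_theta V r t.
Proof. unfold comp_theta, Rdiv; rewrite comp_x_scal, comp_y_scal; ring. Qed.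

Lemma radially_constant_zero : radially_constant zero.
Proof.
apply radially_constant_annulus; exists (1 / 2); split; [lra|].
intros; now rewrite !comp_r_zero, !comp_theta_zero.
Qed.

Lemma radially_constant_plus V W :
  radially_constant V -> radially_constant W -> radially_constant (plus V W).
Proof.
rewrite !radially_constant_annulus; intros [d [Hd HV]] [e [He HW]].
pose proof (Rmin_l d e); pose proof (Rmin_r d e).
exists (Rmin d e); split; [split; [apply Rmin_pos; lra|lra]|].
intros r s t Hr Hs; rewrite !comp_r_plus, !comp_theta_plus.
destruct (HV r s t) as [-> ->]; [lra|lra|].
destruct (HW r s t) as [-> ->]; [lra|lra|easy].
Qed.

Lemma radially_constant_scal (c : R) V :
  radially_constant V -> radially_constant (scal c V).
Proof.
rewrite !radially_constant_annulus; intros [d [Hd HV]].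
exists d; split; [exact Hd|].
intros r s t Hr Hs; rewrite !comp_r_scal, !comp_theta_scal.
now destruct (HV r s t Hr Hs) as [-> ->].
Qed.

Lemma radially_constant_bracket V W :
  radially_constant V -> radially_constant W -> radially_constant (disc_bracket V W).
Proof.
intros RV RW.
destruct (proj1 (near_circle_annulus _) (near_circle_and RV RW)) as [c [Hc HD]].
revert RV RW.
rewrite !radially_constant_annulus; intros [d [Hd HV]] [e [He HW]].
pose proof (Rmin_l c (Rmin d e)); pose proof (Rmin_r c (Rmin d e)).
pose proof (Rmin_l d e); pose proof (Rmin_r d e).
exists (Rmin c (Rmin d e)); split.
{ split; [apply Rmin_pos; [lra|apply Rmin_pos; lra]|lra]. }
assert (D : forall U m r s t, (forall r s t, 1 - m < r < 1 -> 1 - m < s < 1 ->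
    comp_r U r t = comp_r U s t /\ comp_theta U r t = comp_theta U s t) ->
  1 - m < r < 1 -> 1 - m < s < 1 ->
  Derive (comp_r U r) t = Derive (comp_r U s) t /\
  Derive (comp_theta U r) t = Derive (comp_theta U s) t).
{ intros U m r s t HU Hr Hs; split; apply Derive_ext; intros u;
  [exact (proj1 (HU r s u Hr Hs))|exact (proj2 (HU r s u Hr Hs))]. }
assert (F : forall r t, 1 - Rmin c (Rmin d e) < r < 1 ->
  comp_r (disc_bracket V W) r t =
    comp_theta V r t * Derive (comp_r W r) t - comp_theta W r t * Derive (comp_r V r) t /\
  comp_theta (disc_bracket V W) r t =
    comp_theta V r t * Derive (comp_theta W r) t
    - comp_theta W r t * Derive (comp_theta V r) t).
{ intros r t Hr; destruct (HD r t) as [[? ?] [? ?]]; [lra|].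
  apply comp_bracket; try assumption; lra. }
intros r s t Hr Hs.
destruct (F r t Hr) as [-> ->], (F s t Hs) as [-> ->].
destruct (HV r s t) as [_ ->]; [lra|lra|].
destruct (HW r s t) as [_ ->]; [lra|lra|].
destruct (D V d r s t HV) as [-> ->]; [lra|lra|].
destruct (D W e r s t HW) as [-> ->]; [lra|lra|easy].
Qed.

Definition ar_subalgebra : subalgebra GVect.
Proof.
unshelve refine (@Build_subalgebra GVect
  (@Build_subspace GVect asymptotically_radial _ _ _) _).
- apply radially_constant_ar, radially_constant_zero.
- intros V W [_ [_ RV]] [_ [_ RW]].
  now apply radially_constant_ar, radially_constant_plus.
- intros c V [_ [_ RV]]; now apply radially_constant_ar, radially_constant_scal.
- intros V W [_ [_ RV]] [_ [_ RW]].
  now apply radially_constant_ar, radially_constant_bracket.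
Defined.

Definition GVect_ar : LieAlgebra := subalgebra_lie ar_subalgebra.

Definition field_of (V : GVect_ar) : disc_space := proj1_sig V.

Lemma field_of_radial V : radially_constant (field_of V).
Proof. exact (proj2 (proj2 (proj2_sig V))). Qed.

Definition Vect_az : ideal GVect_ar.
Proof.
unshelve refine (@Build_ideal GVect_ar
  (@Build_subspace GVect_ar (fun V => asymptotically_zero (field_of V)) _ _ _) _).
- apply near_circle_true; intros r t.
  split; [exact (comp_r_zero r t)|exact (comp_theta_zero r t)].
- intros V W AV AW; refine (near_circle_mono _ (near_circle_and AV AW)).
  intros r t _ [[v3 v4] [w3 w4]]; split.
  + transitivity (comp_r (field_of V) r t + comp_r (field_of W) r t);
      [exact (comp_r_plus (field_of V) (field_of W) r t)|lra].
  + transitivity (comp_theta (field_of V) r t + comp_theta (field_of W) r t);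
      [exact (comp_theta_plus (field_of V) (field_of W) r t)|lra].
- intros c V AV; refine (near_circle_mono _ AV).
  intros r t _ [v3 v4]; split.
  + transitivity (c * comp_r (field_of V) r t);
      [exact (comp_r_scal c (field_of V) r t)|rewrite v3; ring].
  + transitivity (c * comp_theta (field_of V) r t);
      [exact (comp_theta_scal c (field_of V) r t)|rewrite v4; ring].
- intros V W AW.
  change (asymptotically_zero (disc_bracket (field_of V) (field_of W))).
  destruct (proj1 (near_circle_annulus _) (near_circle_and AW
    (near_circle_and (field_of_radial V) (field_of_radial W)))) as [d [Hd H]].
  apply near_circle_annulus; exists d; split; [exact Hd|]; intros r t Hr.
  destruct (H r t Hr) as [[w3 w4] [[? ?] [? ?]]].
  destruct (@comp_bracket (field_of V) (field_of W) r t) as [-> ->];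
    try assumption; [lra|].
  rewrite w4, (Derive_ext (comp_r (field_of W) r) (fun _ => 0)),
    (Derive_ext (comp_theta (field_of W) r) (fun _ => 0)), Derive_const
    by (intros s; now apply (H r s Hr)).
  split; ring.
Defined.

(* Main.v *)
Require Import Defs.
From Stdlib Require Import Reals Lra Lia ZArith.
From Stdlib Require Import ClassicalEpsilon FunctionalExtensionality.
From Coquelicot Require Import Coquelicot.
Open Scope R_scope.

Set Implicit Arguments.
Unset Strict Implicit.

(* The isomorphism sends the class of [V] to the pair (V4, V3) of polar
   components of [V] near the circle, which there depend on the angle only.
   Its kernel is Vect_az by definition, and the bracket of two fields without
   radial dependence is (v w' - v' w) d/dtheta in the angular part and
   v1 w2' - v2 w1' in the radial part, i.e. the semidirect bracket.
   Surjectivity needs an extension of boundary data to the disc: multiply by a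
   smooth radial cutoff.  Functions f(r) u(theta) with f vanishing near 0 are
   smooth on the plane because the span of such functions is stable under
   d/dx = cos(theta) d/dr - (sin(theta)/r) d/dtheta and likewise d/dy. *)

(** * Smooth functions of one variable *)

(** Smoothness becomes the choice of a class stable under [Derive]: one inducts on the order for all
    members at once, without formulas for the higher derivatives. *)
Lemma smooth1_coind (C : (R -> R) -> Prop) :
  (forall f, C f -> (forall x, ex_derive f x) /\ C (Derive f)) ->
  forall f, C f -> smooth1 f.
Proof.
intros H f Cf n; revert f Cf; induction n as [|n IH]; intros f Cf; [easy|].
destruct (H f Cf) as [D CD]; apply ex_derive_n_S; [exact D|now apply IH].
Qed.

Lemma smooth1_ext f g : (forall x, f x = g x) -> smooth1 f -> smooth1 g.
Proof. intros E Hf n x; apply (ex_derive_n_ext f); [exact E|apply Hf]. Qed.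

Lemma smooth1_id : smooth1 (fun x => x).
Proof.
intros [|n]; [easy|]; apply ex_derive_n_S.
- intros x; apply ex_derive_id.
- intros x; apply (ex_derive_n_ext (fun _ => 1)).
  + intros t; symmetry; apply Derive_id.
  + apply smooth1_const.
Qed.

(** Neither [cos] nor [sin] alone gives a class stable under [Derive]; their span does. *)
Lemma smooth1_trig a b : smooth1 (fun t => a * cos t + b * sin t).
Proof.
apply (@smooth1_coind (fun f => exists a b, forall t, f t = a * cos t + b * sin t));
  [|now exists a, b].
clear; intros f [a [b E]].
apply functional_extensionality in E; subst f; split.
- intros x; auto_derive; easy.
- exists b, (- a); intros t; apply is_derive_unique; auto_derive; [easy|ring].
Qed.

Lemma smooth1_cos : smooth1 cos.
Proof.
apply (smooth1_ext (f := fun t => 1 * cos t + 0 * sin t)); [intros; ring|].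
apply smooth1_trig.
Qed.

Lemma smooth1_sin : smooth1 sin.
Proof.
apply (smooth1_ext (f := fun t => 0 * cos t + 1 * sin t)); [intros; ring|].
apply smooth1_trig.
Qed.

(* Where [g x = 0] the quotient is Rocq's junk value [0], which is smooth
   because the numerator vanishes around [x]. *)
Lemma smooth1_div f g : smooth1 f -> smooth1 g ->
  (forall x, g x <> 0 \/ locally x (fun s => f s = 0)) -> smooth1 (fun x => f x / g x).
Proof.
intros Hf Hg Z.
(* The class consists of the quotients f / g^k for the fixed g. Differentiation replaces f by f' g -
   k f g' and k by k + 1. *)
apply (@smooth1_coind (fun q => exists f k, smooth1 f /\
  (forall x, g x <> 0 \/ locally x (fun s => f s = 0)) /\
  forall x, q x = f x / g x ^ k)).
- clear f Hf Z; intros q [f [k [Hf [Z E]]]].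
  apply functional_extensionality in E; subst q.
  assert (D : forall x, is_derive (fun s => f s / g s ^ k) x
    ((Derive f x * g x - INR k * f x * Derive g x) / g x ^ S k)).
  { intros x; destruct (Z x) as [gx|fx].
    - auto_derive.
      + repeat split; try now apply smooth1_ex. now apply pow_nonzero.
      + change (Derive (fun s => f s)) with (Derive f).
        change (Derive (fun s => g s)) with (Derive g).
        destruct k as [|k]; [simpl; field; exact gx|].
        replace (Init.Nat.pred (S k)) with k by reflexivity.
        rewrite S_INR; simpl; field; split; [now apply pow_nonzero|exact gx].
    - apply (is_derive_ext_loc (fun _ => 0)).
      + revert fx; apply filter_imp; intros s ->.
        symmetry; apply Rdiv_0_l.
      + rewrite (Derive_ext_loc _ _ _ fx), (locally_singleton _ _ fx), Derive_const.
        replace (_ / g x ^ S k) with 0 by (unfold Rdiv; ring).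
        exact (is_derive_const (0 : R) x). }
  split; [intros x; eexists; apply D|].
  exists (fun x => Derive f x * g x - INR k * f x * Derive g x), (S k); split; [|split].
  + apply smooth1_minus; [|apply smooth1_mult; [now apply smooth1_scal|]].
    * apply smooth1_mult; [now apply smooth1_Derive|exact Hg].
    * now apply smooth1_Derive.
  + intros x; destruct (Z x) as [gx|fx]; [now left|right].
    generalize (locally_locally _ _ fx); apply filter_imp; intros s fs.
    rewrite (Derive_ext_loc _ _ _ fs), (locally_singleton _ _ fs), Derive_const; ring.
  + intros x; apply is_derive_unique, D.
- exists f, 1%nat; split; [exact Hf|split; [exact Z|]].
  intros x; now rewrite pow_1.
Qed.

(** * A flat function and smooth cutoffs *)

(** The classical function exp (-1/x), together with its quotients by powers of x: these are what
    differentiation produces. *)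
Definition flat (k : nat) (x : R) : R := if Rlt_dec 0 x then exp (- / x) / x ^ k else 0.

Lemma flat_neg k x : x <= 0 -> flat k x = 0.
Proof. intros H; unfold flat; destruct (Rlt_dec 0 x); lra. Qed.

Lemma flat_pos k x : 0 < x -> 0 < flat k x.
Proof.
intros H; unfold flat; destruct (Rlt_dec 0 x); [|lra].
apply Rdiv_lt_0_compat; [apply exp_pos|now apply pow_lt].
Qed.

(** y^n / n! is one term of the exponential series, whose terms are all nonnegative. *)
Lemma pow_le_exp n y : 0 <= y -> y ^ n <= INR (fact n) * exp y.
Proof.
intros Hy; pose proof (INR_fact_lt_0 n) as F.
assert (T : y ^ n / INR (fact n) <= exp y).
{ eapply Rle_trans; [|apply (exp_ge_taylor y n Hy)].
  destruct n as [|n]; [simpl; lra|]; rewrite tech5.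
  enough (0 <= sum_f_R0 (fun k => y ^ k / INR (fact k)) n) by lra.
  apply cond_pos_sum; intros k; apply Rdiv_le_0_compat; [now apply pow_le|].
  apply INR_fact_lt_0. }
apply (Rmult_le_compat_l (INR (fact n))) in T; [|lra].
replace (y ^ n) with (INR (fact n) * (y ^ n / INR (fact n))) by (field; lra).
exact T.
Qed.

(** This is [pow_le_exp] at 1/x with exponent k + 2. Two powers of x are kept in order to get
    derivative 0 at the origin. *)
Lemma flat_quadratic k x : Rabs (flat k x) <= INR (fact (S (S k))) * x ^ 2.
Proof.
destruct (Rlt_dec 0 x) as [H|H].
- rewrite Rabs_pos_eq by (apply Rlt_le, flat_pos; exact H).
  unfold flat; destruct (Rlt_dec 0 x); [|lra].
  assert (ix : 0 < / x) by now apply Rinv_0_lt_compat.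
  pose proof (@pow_le_exp (S (S k)) (/ x) (Rlt_le _ _ ix)) as P.
  pose proof (exp_pos (- / x)) as E.
  assert (EE : exp (/ x) * exp (- / x) = 1)
    by (rewrite <- exp_plus, Rplus_opp_r; apply exp_0).
  apply (Rmult_le_compat_r (exp (- / x) * x ^ 2)) in P.
  2: { apply Rmult_le_pos; [lra|apply pow2_ge_0]. }
  replace (INR (fact (S (S k))) * exp (/ x) * (exp (- / x) * x ^ 2))
    with (INR (fact (S (S k))) * x ^ 2 * (exp (/ x) * exp (- / x))) in P by ring.
  rewrite EE, Rmult_1_r in P.
  eapply Rle_trans; [|exact P]; right.
  simpl; rewrite pow_inv; field; split; [now apply pow_nonzero; lra|lra].
- rewrite flat_neg, Rabs_R0 by lra.
  apply Rmult_le_pos; [apply pos_INR|apply pow2_ge_0].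
Qed.

Lemma is_derive_flat k x :
  is_derive (flat k) x (flat (S (S k)) x - INR k * flat (S k) x).
Proof.
destruct (Rtotal_order x 0) as [H|[->|H]].
- rewrite !flat_neg by lra.
  apply (is_derive_ext_loc (fun _ => 0)).
  + apply (locally_annulus (a := x - 1) (b := 0)); [lra|].
    intros s Hs; rewrite flat_neg; lra.
  + replace (0 - INR k * 0) with 0 by ring; exact (is_derive_const (0 : R) x).
- rewrite !flat_neg by lra.
  replace (0 - INR k * 0) with 0 by ring.
  apply is_derive_Reals; intros e He.
  pose proof (INR_fact_lt_0 (S (S k))) as F.
  (* With C = (k + 2)!, the quadratic bound makes the difference quotient at most C |h|, which is
     below e for |h| < e / C. *)
  assert (d0 : 0 < e / INR (fact (S (S k)))) by now apply Rdiv_lt_0_compat.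
  exists (mkposreal _ d0); intros h h0 Hh.
  change (Rabs h < e / INR (fact (S (S k)))) in Hh.
  rewrite Rplus_0_l, (flat_neg k (x := 0)), !Rminus_0_r by lra.
  pose proof (flat_quadratic k h) as Q.
  pose proof (Rabs_pos_lt h h0) as ah.
  unfold Rdiv at 1; rewrite Rabs_mult, Rabs_inv.
  revert F Hh Q d0; generalize (INR (fact (S (S k)))); intros C F Hh Q d0.
  rewrite <- (pow2_abs h) in Q.
  apply (Rmult_lt_reg_r (Rabs h)); [exact ah|].
  rewrite Rmult_assoc, Rinv_l, Rmult_1_r by lra.
  eapply Rle_lt_trans; [exact Q|].
  apply (Rmult_lt_compat_l C) in Hh; [|exact F].
  replace (C * (e / C)) with e in Hh by (field; lra).
  apply (Rmult_lt_compat_r (Rabs h)) in Hh; [|exact ah].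
  eapply Rle_lt_trans; [right|exact Hh]; ring.
- apply (is_derive_ext_loc (fun s => exp (- / s) / s ^ k)).
  + apply (locally_annulus (a := 0) (b := x + 1)); [lra|].
    intros s Hs; unfold flat; destruct (Rlt_dec 0 s); lra.
  + unfold flat; destruct (Rlt_dec 0 x); [|lra].
    auto_derive.
    * repeat split; [lra|apply pow_nonzero; lra].
    * destruct k as [|k]; [simpl; field; lra|].
      replace (Init.Nat.pred (S k)) with k by reflexivity.
      rewrite S_INR; simpl; field; split; [apply pow_nonzero|]; lra.
Qed.

Lemma smooth1_flat k : smooth1 (flat k).
Proof.
(* The derivative of [flat k] involves [flat] at k + 1 and k + 2, so k varies in the induction. The
   rule for differences asks for all orders up to m, hence the bound m <= n. *)
intros n; enough (H : forall m, (m <= n)%nat -> forall k x, ex_derive_n (flat k) m x)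
  by now apply H.
clear k; induction n as [|n IH]; intros [|m] Hm k; try easy; try lia.
apply ex_derive_n_S.
- intros x; eexists; apply is_derive_flat.
- intros x; apply (ex_derive_n_ext (fun x => flat (S (S k)) x - INR k * flat (S k) x)).
  + intros t; symmetry; apply is_derive_unique, is_derive_flat.
  + apply ex_derive_n_minus; apply filter_forall; intros t j Hj.
    * apply IH; lia.
    * apply ex_derive_n_scal_l, IH; lia.
Qed.

Lemma smooth1_shift f b : smooth1 f -> smooth1 (fun x => f (x + b)).
Proof. intros Hf n x; apply ex_derive_n_comp_trans, Hf. Qed.

Lemma smooth1_reflect f : smooth1 f -> smooth1 (fun x => f (- x)).
Proof. intros Hf n x; apply ex_derive_n_comp_opp, filter_forall; intros y k _; apply Hf. Qed.

Lemma smooth1_cutoff a b : a < b -> exists chi, smooth1 chi /\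
  (forall x, x <= a -> chi x = 0) /\ (forall x, b <= x -> chi x = 1).
Proof.
intros ab.
(* f vanishes exactly for x <= a and g exactly for x >= b, so f + g is positive everywhere and f /
   (f + g) passes from 0 to 1. *)
pose (f x := flat 0 (x + - a)); pose (g x := flat 0 (- x + b)).
assert (Hf : smooth1 f) by apply (smooth1_shift (- a)), smooth1_flat.
assert (Hg : smooth1 g).
{ apply (smooth1_reflect (f := fun x => flat 0 (x + b))).
  apply smooth1_shift, smooth1_flat. }
assert (N : forall k x, 0 <= flat k x).
{ intros k x; destruct (Rlt_dec 0 x).
  - now apply Rlt_le, flat_pos.
  - rewrite flat_neg; lra. }
assert (P : forall x, 0 < f x + g x).
{ intros x; unfold f, g; destruct (Rlt_dec a x).
  - pose proof (N 0%nat (- x + b)).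
    assert (0 < flat 0 (x + - a)) by (apply flat_pos; lra); lra.
  - pose proof (N 0%nat (x + - a)).
    assert (0 < flat 0 (- x + b)) by (apply flat_pos; lra); lra. }
exists (fun x => f x / (f x + g x)); split; [|split].
- apply smooth1_div; [exact Hf|now apply smooth1_plus|].
  intros x; left; pose proof (P x); lra.
- intros x Hx; unfold f; rewrite flat_neg by lra; apply Rdiv_0_l.
- intros x Hx; pose proof (P x) as Px.
  assert (g0 : g x = 0) by (unfold g; apply flat_neg; lra).
  rewrite g0, Rplus_0_r in *; field; lra.
Qed.

(** * Polar coordinates and periodic functions of the angle *)

Lemma periodic_Z u (k : Z) t : periodic u -> u (t + IZR k * (2 * PI)) = u t.
Proof.
intros P; revert t.
assert (N : forall n t, u (t + INR n * (2 * PI)) = u t).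
{ induction n as [|n IH]; intros t; [change (INR 0) with 0; f_equal; ring|].
  rewrite S_INR, <- (IH t), <- (P (t + INR n * (2 * PI))); f_equal; ring. }
intros t; destruct (Z_le_gt_dec 0 k) as [H|H].
- rewrite <- (Z2Nat.id k H), <- INR_IZR_INZ; apply N.
(* For k < 0, going forward by - k periods from the shifted point leads back to t. *)
- rewrite <- (N (Z.to_nat (- k)) (t + IZR k * (2 * PI))), INR_IZR_INZ, Z2Nat.id by lia.
  rewrite opp_IZR; f_equal; ring.
Qed.

(** The hypotheses give cos (s - t) = 1, hence sin ((s - t) / 2) = 0 by the double angle formula, so
    s - t is a multiple of 2 pi. *)
Lemma periodic_angle u s t : periodic u -> cos s = cos t -> sin s = sin t -> u s = u t.
Proof.
intros P C S.
assert (H : cos (s - t) = 1) by (rewrite cos_minus, C, S; pose proof (cos2_sin2 t); lra).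
replace (s - t) with (2 * ((s - t) / 2)) in H by field.
rewrite cos_2a_sin in H.
assert (Z : sin ((s - t) / 2) = 0) by nra.
destruct (sin_eq_0_0 _ Z) as [k Hk].
rewrite <- (periodic_Z k t P); f_equal; lra.
Qed.

Definition radius (x y : R) : R := sqrt (x ^ 2 + y ^ 2).

(* At the origin every [t] qualifies. *)
Lemma angle_exists x y :
  exists t, radius x y * cos t = x /\ radius x y * sin t = y.
Proof.
unfold radius; destruct (Rlt_dec 0 (x ^ 2 + y ^ 2)) as [H|H].
- destruct (polar_exists (dir_norm H)) as [t [_ [Ct St]]]; exists t; rewrite Ct, St.
  pose proof (sqrt_lt_R0 _ H); unfold dir1, dir2; split; field; lra.
- exists 0; replace x with 0 by nra; replace y with 0 by nra.
  replace (0 ^ 2 + 0 ^ 2) with 0 by ring; rewrite sqrt_0; lra.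
Qed.

(** No choice of angle is continuous on the punctured plane, and this one is arbitrary. Regularity
    is claimed only for periodic functions of it, which do not see the choice away from the
    origin. *)
Definition angle (x y : R) : R :=
  proj1_sig (constructive_indefinite_description _ (angle_exists x y)).

Lemma angle_spec x y :
  radius x y * cos (angle x y) = x /\ radius x y * sin (angle x y) = y.
Proof.
exact (proj2_sig (constructive_indefinite_description _ (angle_exists x y))).
Qed.

Lemma radius_pos x y : 0 <= radius x y.
Proof. apply sqrt_pos. Qed.

Lemma polar_norm2 r t : (r * cos t) ^ 2 + (r * sin t) ^ 2 = r ^ 2.
Proof. transitivity (r ^ 2 * (cos t ^ 2 + sin t ^ 2)); [ring|rewrite cos2_sin2; ring]. Qed.

Lemma radius_polar r t : 0 <= r -> radius (r * cos t) (r * sin t) = r.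
Proof.
intros Hr; unfold radius.
rewrite polar_norm2; now apply sqrt_pow2.
Qed.

Lemma radius_continuous x y : continuity_2d_pt radius x y.
Proof.
apply (continuity_1d_2d_pt_comp sqrt (fun u v => u ^ 2 + v ^ 2)).
- apply continuity_pt_sqrt; nra.
- apply (continuity_2d_pt_ext (fun u v => u * u + v * v)); [intros; ring|].
  apply continuity_2d_pt_plus; apply continuity_2d_pt_mult;
    first [apply continuity_2d_pt_id1|apply continuity_2d_pt_id2].
Qed.

(* A branch of the angle that is smooth on the half plane around the ray of
   angle [t]. *)
Definition angle_near (t x y : R) : R :=
  t + atan ((cos t * y - sin t * x) / (cos t * x + sin t * y)).

(** In the frame rotated by t the point has a positive first coordinate, so the arctangent of the
    quotient of its coordinates is its angle there. The two angles have the same cosine and sine,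
    which suffices for a periodic u. *)
Lemma angle_nearP u t x y : periodic u -> 0 < cos t * x + sin t * y ->
  u (angle x y) = u (angle_near t x y).
Proof.
intros P D.
assert (N : radius x y ^ 2 =
  (cos t * x + sin t * y) ^ 2 + (cos t * y - sin t * x) ^ 2).
{ unfold radius; rewrite pow2_sqrt by nra.
  transitivity ((x ^ 2 + y ^ 2) * (cos t ^ 2 + sin t ^ 2)); [|ring].
  rewrite cos2_sin2; ring. }
assert (r0 : 0 < radius x y).
{ destruct (radius_pos x y) as [H|H]; [exact H|].
  rewrite <- H in N; pose proof (pow_lt _ 2 D).
  pose proof (pow2_ge_0 (cos t * y - sin t * x)); lra. }
destruct (angle_spec x y) as [Ax Ay].
pose proof (cos2_sin2 t) as CS.
unfold angle_near; set (q := (cos t * y - sin t * x) / (cos t * x + sin t * y)).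
(* This root is the denominator in the formulas for the cosine and sine of an arctangent. *)
assert (E : sqrt (1 + q²) = radius x y / (cos t * x + sin t * y)).
{ apply Rsqr_inj; [apply sqrt_pos|apply Rlt_le, Rdiv_lt_0_compat; assumption|].
  rewrite Rsqr_sqrt by (pose proof (Rle_0_sqr q); lra).
  unfold Rsqr, q.
  transitivity (radius x y ^ 2 / (cos t * x + sin t * y) ^ 2); [rewrite N|]; field; lra. }
assert (Cq : cos (atan q) = (cos t * x + sin t * y) / radius x y)
  by (rewrite cos_atan, E; field; lra).
assert (Sq : sin (atan q) = (cos t * y - sin t * x) / radius x y)
  by (rewrite sin_atan, E; unfold q; field; lra).
apply periodic_angle; [exact P| |]; apply (Rmult_eq_reg_l (radius x y)); try lra.
- rewrite Ax, cos_plus, Cq, Sq.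
  transitivity (x * (cos t ^ 2 + sin t ^ 2)); [rewrite CS; ring|field; lra].
- rewrite Ay, sin_plus, Cq, Sq.
  transitivity (y * (cos t ^ 2 + sin t ^ 2)); [rewrite CS; ring|field; lra].
Qed.

(** * Smoothness of the products f(r) u(theta) *)

Definition polar_fun (f u : R -> R) (x y : R) : R := f (radius x y) * u (angle x y).

Lemma polar_fun_polar f u r t : periodic u -> 0 < r ->
  polar_fun f u (r * cos t) (r * sin t) = f r * u t.
Proof.
intros P Hr; unfold polar_fun; rewrite radius_polar by lra; f_equal.
destruct (angle_spec (r * cos t) (r * sin t)) as [Ax Ay].
rewrite radius_polar in Ax, Ay by lra.
apply periodic_angle; [exact P| |]; apply (Rmult_eq_reg_l r); lra.
Qed.

(** Negative r are included: [f r / r] is then smooth on the whole line, and the condition passes to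
    [Derive f] with the same e. *)
Definition vanishes_near_0 (f : R -> R) : Prop := exists e, 0 < e /\ forall r, r < e -> f r = 0.

Lemma polar_fun_0_locally f u : vanishes_near_0 f ->
  locally_2d (fun x y => polar_fun f u x y = 0) 0 0.
Proof.
intros [e [He Hf]].
destruct (radius_continuous 0 0 (mkposreal e He)) as [d Hd].
exists d; intros x y Hx Hy; specialize (Hd x y Hx Hy); simpl in Hd.
unfold polar_fun; rewrite Hf; [ring|].
unfold radius in Hd at 2; replace (0 ^ 2 + 0 ^ 2) with 0 in Hd by ring.
rewrite sqrt_0, Rminus_0_r in Hd; apply Rabs_def2 in Hd; lra.
Qed.

Lemma polar_fun_0_at f u : vanishes_near_0 f -> polar_fun f u 0 0 = 0.
Proof. intros Vf; exact (locally_2d_singleton _ _ _ (polar_fun_0_locally u Vf)). Qed.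

Lemma vanishes_Derive f : vanishes_near_0 f -> vanishes_near_0 (Derive f).
Proof.
intros [e [He Hf]]; exists e; split; [exact He|]; intros r Hr.
rewrite (Derive_ext_loc f (fun _ => 0)); [apply Derive_const|].
apply (locally_annulus (a := r - 1) (b := e)); [lra|]; intros s Hs; apply Hf; lra.
Qed.

Lemma vanishes_div f : vanishes_near_0 f -> vanishes_near_0 (fun r => f r / r).
Proof.
intros [e [He Hf]]; exists e; split; [exact He|]; intros r Hr.
rewrite Hf by exact Hr; apply Rdiv_0_l.
Qed.

(** Replaces the arbitrary [angle] by a smooth branch, on which continuity and derivatives can be
    computed. *)
Lemma polar_fun_locally f u r t : periodic u -> 0 < r ->
  locally_2d (fun x y => f (radius x y) * u (angle_near t x y) = polar_fun f u x y)
    (r * cos t) (r * sin t).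
Proof.
intros P Hr.
assert (C : continuity_2d_pt (fun x y => cos t * x + sin t * y) (r * cos t) (r * sin t)).
{ apply continuity_2d_pt_plus; apply continuity_2d_pt_mult; try apply continuity_2d_pt_const;
    first [apply continuity_2d_pt_id1|apply continuity_2d_pt_id2]. }
(* The linear form equals r at the point itself, so a variation below r keeps it positive. *)
destruct (C (mkposreal r Hr)) as [d Hd].
exists d; intros x y Hx Hy; specialize (Hd x y Hx Hy); simpl in Hd.
unfold polar_fun; f_equal; symmetry; apply angle_nearP; [exact P|].
replace (cos t * (r * cos t) + sin t * (r * sin t))
  with (r * (cos t ^ 2 + sin t ^ 2)) in Hd by ring.
rewrite cos2_sin2 in Hd; apply Rabs_def2 in Hd; lra.
Qed.

Lemma polar_ind (Q : R -> R -> Prop) :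
  Q 0 0 -> (forall r t, 0 < r -> Q (r * cos t) (r * sin t)) -> forall x y, Q x y.
Proof.
intros Q0 Q1 x y; pose proof (radius_pos x y) as H.
destruct (angle_spec x y) as [Hx Hy].
revert Hx Hy H; generalize (radius x y) (angle x y); intros r t <- <- [H|<-].
- now apply Q1.
- now rewrite !Rmult_0_l.
Qed.

Lemma polar_fun_continuous f u x y : smooth1 f -> vanishes_near_0 f ->
  smooth1 u -> periodic u -> continuity_2d_pt (polar_fun f u) x y.
Proof.
intros Hf Vf Hu P.
assert (K : forall g z, smooth1 g -> continuity_pt g z).
{ intros g z Hg; apply continuity_pt_filterlim, (ex_derive_continuous g); now apply smooth1_ex. }
revert x y; apply polar_ind.
- apply (continuity_2d_pt_ext_loc (fun _ _ => 0)); [|apply continuity_2d_pt_const].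
  destruct (polar_fun_0_locally u Vf) as [d Hd].
  exists d; intros x y Hx Hy; symmetry; auto.
- intros r t Hr.
  apply (continuity_2d_pt_ext_loc (fun x y => f (radius x y) * u (angle_near t x y)));
    [now apply polar_fun_locally|].
  apply continuity_2d_pt_mult; apply continuity_1d_2d_pt_comp; try apply radius_continuous;
    try now apply K.
  apply continuity_2d_pt_plus; [apply continuity_2d_pt_const|].
  apply continuity_1d_2d_pt_comp.
  + apply continuity_pt_filterlim, (ex_derive_continuous atan); auto_derive; easy.
  + assert (L : forall a b x y, continuity_2d_pt (fun x y => a * x + b * y) x y).
    { intros a b x y; apply continuity_2d_pt_plus; apply continuity_2d_pt_mult;
        try apply continuity_2d_pt_const;
        first [apply continuity_2d_pt_id1|apply continuity_2d_pt_id2]. }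
    apply continuity_2d_pt_mult.
    * apply (continuity_2d_pt_ext (fun x y => - sin t * x + cos t * y)); [intros; ring|].
      apply L.
    * apply continuity_2d_pt_inv; [apply L|].
      replace (cos t * (r * cos t) + sin t * (r * sin t))
        with (r * (cos t ^ 2 + sin t ^ 2)) by ring.
      rewrite cos2_sin2; lra.
Qed.

(** The values of a and b at s enter through equations, so that the derivative comes out in terms of
    r and t when a is a radius and b an angle. *)
Lemma is_derive_mult_comp f u (a b : R -> R) s r t da db : smooth1 f -> smooth1 u ->
  a s = r -> b s = t -> is_derive a s da -> is_derive b s db ->
  is_derive (fun s => f (a s) * u (b s)) s
    (da * Derive f r * u t + f r * (db * Derive u t)).
Proof.
intros Hf Hu <- <- Da Db.
pose proof (is_derive_comp f a s _ _ (Derive_correct _ _ (smooth1_ex (a s) Hf)) Da) as Df.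
pose proof (is_derive_comp u b s _ _ (Derive_correct _ _ (smooth1_ex (b s) Hu)) Db) as Du.
exact (is_derive_mult (fun s => f (a s)) (fun s => u (b s)) s _ _ Df Du Rmult_comm).
Qed.

Lemma angle_near_ray t r : angle_near t (r * cos t) (r * sin t) = t.
Proof.
unfold angle_near; replace (_ - _) with 0 by ring.
rewrite Rdiv_0_l, atan_0; ring.
Qed.

Section PolarPartials.
Variables (r t : R).
Hypothesis Hr : 0 < r.

Lemma is_derive_radius_x : is_derive (fun x => radius x (r * sin t)) (r * cos t) (cos t).
Proof.
unfold radius.
pose proof (polar_norm2 r t) as e.
auto_derive; simpl in e |- *; [nra|].
rewrite !Rmult_1_r in *; rewrite e, sqrt_square by lra; field; lra.
Qed.

Lemma is_derive_radius_y : is_derive (fun y => radius (r * cos t) y) (r * sin t) (sin t).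
Proof.
unfold radius.
pose proof (polar_norm2 r t) as e.
auto_derive; simpl in e |- *; [nra|].
rewrite !Rmult_1_r in *; rewrite e, sqrt_square by lra; field; lra.
Qed.

Lemma ray_denominator : cos t * (r * cos t) + sin t * (r * sin t) = r.
Proof.
transitivity (r * (cos t ^ 2 + sin t ^ 2)); [ring|rewrite cos2_sin2; ring].
Qed.

Lemma is_derive_angle_near_x :
  is_derive (fun x => angle_near t x (r * sin t)) (r * cos t) (- sin t / r).
Proof.
unfold angle_near; pose proof ray_denominator as e.
auto_derive; rewrite ?e; [lra|].
(* On the ray of angle t the argument of [atan] is 0, where its derivative is 1. *)
replace (cos t * (r * sin t) + - (sin t * (r * cos t))) with 0 by ring.
field; lra.
Qed.

Lemma is_derive_angle_near_y :
  is_derive (fun y => angle_near t (r * cos t) y) (r * sin t) (cos t / r).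
Proof.
unfold angle_near; pose proof ray_denominator as e.
auto_derive; rewrite ?e; [lra|].
replace (cos t * (r * sin t) + - (sin t * (r * cos t))) with 0 by ring.
field; lra.
Qed.
End PolarPartials.

Lemma cos_periodic : periodic cos.
Proof. intros t; rewrite cos_plus, cos_2PI, sin_2PI; ring. Qed.

Lemma sin_periodic : periodic sin.
Proof. intros t; rewrite sin_plus, cos_2PI, sin_2PI; ring. Qed.

(** Both terms are again products of a radial and an angular function, the factor 1/r going to the
    radial one; [smooth2_polar_fun] iterates this. *)
Lemma is_derive_polar_fun_x f u x y : smooth1 f -> vanishes_near_0 f ->
  smooth1 u -> periodic u ->
  is_derive (fun s => polar_fun f u s y) x
    (polar_fun (Derive f) (fun t => cos t * u t) x y
     + polar_fun (fun r => f r / r) (fun t => - sin t * Derive u t) x y).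
Proof.
intros Hf Vf Hu P; revert x y; apply polar_ind.
- rewrite (polar_fun_0_at _ (vanishes_Derive Vf)), (polar_fun_0_at _ (vanishes_div Vf)),
    Rplus_0_r.
  apply (is_derive_ext_loc (fun _ => 0)); [|exact (is_derive_const (0 : R) 0)].
  destruct (polar_fun_0_locally u Vf) as [d Hd]; exists d; intros s Hs; symmetry.
  apply Hd; [exact Hs|rewrite Rminus_0_r, Rabs_R0; apply cond_pos].
- intros r t Hr.
  apply (is_derive_ext_loc
    (fun s => f (radius s (r * sin t)) * u (angle_near t s (r * sin t)))).
  { destruct (polar_fun_locally f t P Hr) as [d Hd]; exists d; intros s Hs.
    apply Hd; [exact Hs|rewrite Rminus_diag, Rabs_R0; apply cond_pos]. }
  rewrite !polar_fun_polar; try exact Hr.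
  + replace (_ + _)
      with (cos t * Derive f r * u t + f r * (- sin t / r * Derive u t)) by (field; lra).
    apply (is_derive_mult_comp Hf Hu).
    * apply radius_polar; lra.
    * apply angle_near_ray.
    * now apply is_derive_radius_x.
    * now apply is_derive_angle_near_x.
  + intros s; now rewrite sin_periodic, (periodic_Derive P).
  + intros s; now rewrite cos_periodic, P.
Qed.

Lemma is_derive_polar_fun_y f u x y : smooth1 f -> vanishes_near_0 f ->
  smooth1 u -> periodic u ->
  is_derive (fun s => polar_fun f u x s) y
    (polar_fun (Derive f) (fun t => sin t * u t) x y
     + polar_fun (fun r => f r / r) (fun t => cos t * Derive u t) x y).
Proof.
intros Hf Vf Hu P; revert x y; apply polar_ind.
- rewrite (polar_fun_0_at _ (vanishes_Derive Vf)), (polar_fun_0_at _ (vanishes_div Vf)),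
    Rplus_0_r.
  apply (is_derive_ext_loc (fun _ => 0)); [|exact (is_derive_const (0 : R) 0)].
  destruct (polar_fun_0_locally u Vf) as [d Hd]; exists d; intros s Hs; symmetry.
  apply Hd; [rewrite Rminus_0_r, Rabs_R0; apply cond_pos|exact Hs].
- intros r t Hr.
  apply (is_derive_ext_loc
    (fun s => f (radius (r * cos t) s) * u (angle_near t (r * cos t) s))).
  { destruct (polar_fun_locally f t P Hr) as [d Hd]; exists d; intros s Hs.
    apply Hd; [rewrite Rminus_diag, Rabs_R0; apply cond_pos|exact Hs]. }
  rewrite !polar_fun_polar; try exact Hr.
  + replace (_ + _)
      with (sin t * Derive f r * u t + f r * (cos t / r * Derive u t)) by (field; lra).
    apply (is_derive_mult_comp Hf Hu).
    * apply radius_polar; lra.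
    * apply angle_near_ray.
    * now apply is_derive_radius_y.
    * now apply is_derive_angle_near_y.
  + intros s; now rewrite cos_periodic, (periodic_Derive P).
  + intros s; now rewrite sin_periodic, P.
Qed.

(** Induction on the order for all f and u at once, since a partial derivative changes both. *)
Lemma smooth2_polar_fun f u : smooth1 f -> vanishes_near_0 f ->
  smooth1 u -> periodic u -> smooth2 (polar_fun f u).
Proof.
intros Hf Vf Hu P n; revert f u Hf Vf Hu P.
enough (H : forall f u, smooth1 f -> vanishes_near_0 f -> smooth1 u -> periodic u ->
  cdiff n (polar_fun f u)) by exact H.
induction n as [|n IH]; intros f u Hf Vf Hu P.
- intros x y _; split; [now apply polar_fun_continuous|easy].
(* For r < e the numerator vanishes around r; for r >= e the denominator is nonzero. *)
- assert (Q : smooth1 (fun r => f r / r)).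
  { apply smooth1_div; [exact Hf|exact smooth1_id|]; intros r.
    destruct Vf as [e [He Vf]].
    destruct (Rlt_dec r e) as [H|H]; [right|left; lra].
    apply (locally_annulus (a := r - 1) (b := e)); [lra|]; intros s Hs; apply Vf; lra. }
  apply cdiff_S.
  + intros x y _; now apply polar_fun_continuous.
  + intros x y _; eexists; now apply is_derive_polar_fun_x.
  + intros x y _; eexists; now apply is_derive_polar_fun_y.
  + apply (cdiff_ext (f := fun x y => polar_fun (Derive f) (fun t => cos t * u t) x y
      + polar_fun (fun r => f r / r) (fun t => - sin t * Derive u t) x y)).
    * intros x y _; symmetry; apply is_derive_unique; now apply is_derive_polar_fun_x.
    * apply cdiff_plus; apply IH; auto using smooth1_Derive, vanishes_Derive, vanishes_div.
      -- exact (smooth1_mult smooth1_cos Hu).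
      -- intros s; now rewrite cos_periodic, P.
      -- apply (smooth1_ext (f := fun t => (-1) * (sin t * Derive u t))); [intros; ring|].
         exact (smooth1_scal (-1) (smooth1_mult smooth1_sin (smooth1_Derive Hu))).
      -- intros s; now rewrite sin_periodic, (periodic_Derive P).
  + apply (cdiff_ext (f := fun x y => polar_fun (Derive f) (fun t => sin t * u t) x y
      + polar_fun (fun r => f r / r) (fun t => cos t * Derive u t) x y)).
    * intros x y _; symmetry; apply is_derive_unique; now apply is_derive_polar_fun_y.
    * apply cdiff_plus; apply IH; auto using smooth1_Derive, vanishes_Derive, vanishes_div.
      -- exact (smooth1_mult smooth1_sin Hu).
      -- intros s; now rewrite sin_periodic, P.
      -- exact (smooth1_mult smooth1_cos (smooth1_Derive Hu)).
      -- intros s; now rewrite cos_periodic, (periodic_Derive P).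
Qed.

(** * Polar components of a field restricted to a circle *)

Lemma smooth2_x : smooth2 (fun x y => x).
Proof.
intros [|n].
- intros x y _; split; [apply continuity_2d_pt_id1|easy].
- apply cdiff_S.
  + intros; apply continuity_2d_pt_id1.
  + intros; apply ex_derive_id.
  + intros; apply ex_derive_const.
  + apply (cdiff_ext (f := fun _ _ => 1)); [|apply cdiff_const].
    intros x y _; symmetry; exact (Derive_id x).
  + apply (cdiff_ext (f := fun _ _ => 0)); [|apply cdiff_const].
    intros x y _; symmetry; exact (Derive_const x y).
Qed.

Lemma smooth2_y : smooth2 (fun x y => y).
Proof.
intros [|n].
- intros x y _; split; [apply continuity_2d_pt_id2|easy].
- apply cdiff_S.
  + intros; apply continuity_2d_pt_id2.
  + intros; apply ex_derive_const.
  + intros; apply ex_derive_id.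
  + apply (cdiff_ext (f := fun _ _ => 0)); [|apply cdiff_const].
    intros x y _; symmetry; exact (Derive_const y x).
  + apply (cdiff_ext (f := fun _ _ => 1)); [|apply cdiff_const].
    intros x y _; symmetry; exact (Derive_id y).
Qed.

(** The angular derivative of the restriction is the restriction of x df/dy - y df/dx, again smooth
    on the disc: restrictions form a class stable under [Derive]. *)
Lemma smooth1_on_circle f r : smooth2 f -> -1 < r < 1 ->
  smooth1 (fun t => f (r * cos t) (r * sin t)).
Proof.
intros Hf Hr.
apply (@smooth1_coind (fun v => exists f, smooth2 f /\
  forall t, v t = f (r * cos t) (r * sin t))); [|now exists f].
clear f Hf; intros v [f [Hf E]].
apply functional_extensionality in E; subst v; split.
- intros t; eexists; now apply is_derive_angular.
- exists (fun x y => x * pdy f x y - y * pdx f x y); split.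
  + apply smooth2_minus; apply smooth2_mult;
      auto using smooth2_x, smooth2_y, smooth2_pdx, smooth2_pdy.
  + intros t; etransitivity; [exact (is_derive_unique _ _ _ (is_derive_angular t Hf Hr))|ring].
Qed.

Lemma smooth1_comp_r V r : 0 < r < 1 -> smooth1 (comp_r V r).
Proof.
intros Hr; assert (Hr' : -1 < r < 1) by lra.
exact (smooth1_plus
  (smooth1_mult smooth1_cos (smooth1_on_circle (comp_x_smooth V) Hr'))
  (smooth1_mult smooth1_sin (smooth1_on_circle (comp_y_smooth V) Hr'))).
Qed.

Lemma smooth1_comp_theta V r : 0 < r < 1 -> smooth1 (comp_theta V r).
Proof.
intros Hr; assert (Hr' : -1 < r < 1) by lra.
apply (smooth1_ext (f := fun t => / r *
  (cos t * comp_y V (r * cos t) (r * sin t) - sin t * comp_x V (r * cos t) (r * sin t)))).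
{ intros t; apply Rmult_comm. }
exact (smooth1_scal (/ r) (smooth1_minus
  (smooth1_mult smooth1_cos (smooth1_on_circle (comp_y_smooth V) Hr'))
  (smooth1_mult smooth1_sin (smooth1_on_circle (comp_x_smooth V) Hr')))).
Qed.

Lemma periodic_comp_r V r : periodic (comp_r V r).
Proof. intros t; unfold comp_r; now rewrite cos_periodic, sin_periodic. Qed.

Lemma periodic_comp_theta V r : periodic (comp_theta V r).
Proof. intros t; unfold comp_theta; now rewrite cos_periodic, sin_periodic. Qed.

(** * Fields with prescribed boundary values *)

Lemma disc_field_exists f g : smooth2 f -> smooth2 g -> exists V : disc_space,
  forall x y, in_disc x y -> comp_x V x y = f x y /\ comp_y V x y = g x y.
Proof.
intros Hf Hg.
(* The encoding requires components that are 0 off the disc; truncation keeps [smooth2], which is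
   tested only inside. *)
pose (cut h x y := if Rlt_dec (x ^ 2 + y ^ 2) 1 then h x y else 0 : R).
assert (E : forall h x y, in_disc x y -> h x y = cut h x y).
{ intros h x y H; unfold cut, in_disc in *; now destruct (Rlt_dec (x ^ 2 + y ^ 2) 1). }
assert (O : forall h x y, ~ in_disc x y -> cut h x y = 0).
{ intros h x y H; unfold cut, in_disc in *; now destruct (Rlt_dec (x ^ 2 + y ^ 2) 1). }
unshelve eexists (exist _ (cut f, cut g) _).
- split; [exact (smooth2_ext (E f) Hf)|split; [exact (smooth2_ext (E g) Hg)|]].
  intros x y H; split; now apply O.
- intros x y H; split; symmetry; now apply E.
Qed.

(** The field is chi(r) (w d/dr + v d/dtheta), with chi equal to 0 near the origin and to 1 near the
    circle. The factor r in d/dtheta is absorbed into the radial function r chi(r). *)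
Lemma disc_field_with_boundary v w : smooth1 v -> periodic v -> smooth1 w -> periodic w ->
  exists V : disc_space,
    near_circle (fun r t => comp_theta V r t = v t /\ comp_r V r t = w t).
Proof.
intros Sv Pv Sw Pw.
destruct (@smooth1_cutoff (1 / 4) (1 / 2)) as [chi [Schi [chi0 chi1]]]; [lra|].
assert (V1 : vanishes_near_0 chi).
{ exists (1 / 4); split; [lra|]; intros r Hr; apply chi0; lra. }
assert (V2 : vanishes_near_0 (fun r => r * chi r)).
{ exists (1 / 4); split; [lra|]; intros r Hr; rewrite chi0 by lra; ring. }
pose proof (smooth1_mult smooth1_id Schi) as Srchi.
(* One pattern for both Cartesian components: with u = w and z = v, the pair (p, q) is (cos, - sin)
   for the first and (sin, cos) for the second. *)
assert (S : forall p q u z, smooth1 p -> smooth1 q -> periodic p -> periodic q ->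
  smooth1 u -> periodic u -> smooth1 z -> periodic z ->
  smooth2 (fun x y => polar_fun chi (fun t => p t * u t) x y
    + polar_fun (fun r => r * chi r) (fun t => q t * z t) x y)).
{ intros p q u z Sp Sq Pp Pq Su Pu Sz Pz; apply smooth2_plus; apply smooth2_polar_fun;
    try assumption; try now apply smooth1_mult.
  - intros t; now rewrite Pp, Pu.
  - intros t; now rewrite Pq, Pz. }
assert (Sm : smooth1 (fun t => - sin t)).
{ apply (smooth1_ext (f := fun t => -1 * sin t)); [intros; ring|].
  exact (smooth1_scal (-1) smooth1_sin). }
assert (Pm : periodic (fun t => - sin t)) by (intros t; now rewrite sin_periodic).
destruct (disc_field_exists
  (S _ _ w v smooth1_cos Sm cos_periodic Pm Sw Pw Sv Pv)
  (S _ _ w v smooth1_sin smooth1_cos sin_periodic cos_periodic Sw Pw Sv Pv)) as [V HV].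
exists V; apply near_circle_annulus; exists (1 / 2); split; [lra|]; intros r t Hr.
destruct (HV (r * cos t) (r * sin t)) as [Hx Hy]; [apply in_disc_polar; lra|].
rewrite !polar_fun_polar in Hx, Hy; try lra;
  try (intros s; now rewrite ?cos_periodic, ?sin_periodic, ?Pv, ?Pw).
rewrite chi1 in Hx, Hy by lra.
unfold comp_theta, comp_r; rewrite Hx, Hy; split.
- transitivity (v t * (cos t ^ 2 + sin t ^ 2)); [field; lra|rewrite cos2_sin2; ring].
- transitivity (w t * (cos t ^ 2 + sin t ^ 2)); [ring|rewrite cos2_sin2; ring].
Qed.

(** * The boundary map and its compatibility with the operations *)

(** Stated as a relation so that each operation can be checked pointwise near the circle. The
    angular part goes to the acting factor, the radial part to the abelian one. *)
Definition boundary_values (V : disc_space) (p : semidirect VectS1_action) : Prop :=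
  near_circle (fun r t =>
    comp_theta V r t = circle_fun (fst p) t /\ comp_r V r t = circle_fun (snd p) t).

Lemma near_circle_const (P : R -> Prop) : near_circle (fun _ t => P t) -> forall t, P t.
Proof.
intros H t; destruct (proj1 (near_circle_annulus _) H) as [d [Hd HP]].
apply (HP (1 - d / 2)); lra.
Qed.

Lemma boundary_values_unique V p q : boundary_values V p -> boundary_values V q -> p = q.
Proof.
intros Hp Hq.
assert (H : forall t, circle_fun (fst p) t = circle_fun (fst q) t /\
  circle_fun (snd p) t = circle_fun (snd q) t).
{ apply near_circle_const; refine (near_circle_mono _ (near_circle_and Hp Hq)).
  intros r t _ [[<- <-] E]; exact E. }
apply pair_eq; apply circle_fun_ext; intros t; apply H.
Qed.

Lemma boundary_values_exist V : radially_constant V -> exists p, boundary_values V p.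
Proof.
intros H; destruct (proj1 (radially_constant_annulus V) H) as [d [Hd HV]].
assert (Hr : 0 < 1 - d / 2 < 1) by lra.
(* The components are read off on the circle of radius 1 - d/2, inside the annulus where they do not
   depend on r; smoothness in the angle holds there because the circle lies in the open disc. *)
exists (exist circle_functions (comp_theta V (1 - d / 2))
          (conj (@periodic_comp_theta V (1 - d / 2)) (smooth1_comp_theta V Hr)),
        exist circle_functions (comp_r V (1 - d / 2))
          (conj (@periodic_comp_r V (1 - d / 2)) (smooth1_comp_r V Hr))).
apply near_circle_annulus; exists d; split; [exact Hd|]; intros r t Hrt.
destruct (HV r (1 - d / 2) t) as [E3 E4]; [lra|lra|]; now split.
Qed.

Lemma boundary_values_plus V W p q : boundary_values V p -> boundary_values W q ->
  boundary_values (plus V W) (plus p q).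
Proof.
intros Hp Hq; refine (near_circle_mono _ (near_circle_and Hp Hq)).
intros r t _ [[E1 E2] [F1 F2]].
rewrite comp_theta_plus, comp_r_plus, E1, E2, F1, F2; now split.
Qed.

Lemma boundary_values_scal (c : R) V p : boundary_values V p ->
  boundary_values (scal c V) (scal c p).
Proof.
intros Hp; refine (near_circle_mono _ Hp); intros r t _ [E1 E2].
rewrite comp_theta_scal, comp_r_scal, E1, E2; now split.
Qed.

Lemma boundary_values_bracket V W p q : radially_constant V -> radially_constant W ->
  boundary_values V p -> boundary_values W q ->
  boundary_values (disc_bracket V W) (bracket p q).
Proof.
intros RV RW Hp Hq.
destruct (proj1 (near_circle_annulus _) (near_circle_and (near_circle_and RV RW)
  (near_circle_and Hp Hq))) as [d [Hd H]].
apply near_circle_annulus; exists d; split; [exact Hd|]; intros r t Hr.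
destruct (H r t Hr) as [[[V3 V4] [W3 W4]] [[E4 E3] [F4 F3]]].
destruct (@comp_bracket V W r t) as [-> ->]; try assumption; [lra|].
rewrite E4, F4.
(* At the fixed r the equality with the boundary data holds for every angle, so it may be
   differentiated in the angle. *)
rewrite (Derive_ext (comp_r V r) (circle_fun (snd p))) by (intros s; now apply (H r s Hr)).
rewrite (Derive_ext (comp_r W r) (circle_fun (snd q))) by (intros s; now apply (H r s Hr)).
rewrite (Derive_ext (comp_theta V r) (circle_fun (fst p))) by (intros s; now apply (H r s Hr)).
rewrite (Derive_ext (comp_theta W r) (circle_fun (fst q))) by (intros s; now apply (H r s Hr)).
split.
- change (circle_fun (fst (@bracket (semidirect VectS1_action) p q)) t)
    with (circle_fun (circle_bracket (fst p) (fst q)) t).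
  rewrite circle_fun_bracket; ring.
- change (circle_fun (snd (@bracket (semidirect VectS1_action) p q)) t)
    (* The bracket of the abelian factor is [zero]; only the two action terms remain. *)
    with (circle_fun (minus (plus zero (circle_act (fst p) (snd q)))
      (circle_act (fst q) (snd p))) t).
  rewrite circle_fun_minus, circle_fun_plus, circle_fun_zero, !circle_fun_act; ring.
Qed.

Lemma boundary_values_zero V : boundary_values V zero <-> asymptotically_zero V.
Proof.
split; apply near_circle_mono; intros r t _ [E1 E2]; split; assumption.
Qed.

Lemma boundary_values_surj p : exists V : GVect_ar, boundary_values (field_of V) p.
Proof.
destruct (disc_field_with_boundary (circle_fun_smooth (fst p)) (circle_fun_periodic (fst p))
  (circle_fun_smooth (snd p)) (circle_fun_periodic (snd p))) as [V HV].
assert (RV : radially_constant V).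
{ destruct (proj1 (near_circle_annulus _) HV) as [d [Hd H]].
  apply radially_constant_annulus; exists d; split; [exact Hd|]; intros r s t Hr Hs.
  destruct (H r t Hr) as [-> ->], (H s t Hs) as [-> ->]; now split. }
now exists (exist _ V (radially_constant_ar RV)).
Qed.

(** [zero] only witnesses that the type is inhabited; on the fields of [GVect_ar] the value is the
    true one by [boundary_spec]. *)
Definition boundary (V : disc_space) : semidirect VectS1_action :=
  epsilon (inhabits zero) (boundary_values V).

Lemma boundary_spec (V : GVect_ar) : boundary_values (field_of V) (boundary (field_of V)).
Proof.
exact (epsilon_spec _ _ (boundary_values_exist (field_of_radial V))).
Qed.

Lemma boundary_eq (V : GVect_ar) p : boundary_values (field_of V) p ->
  boundary (field_of V) = p.
Proof. apply boundary_values_unique, boundary_spec. Qed.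

Lemma boundary_plus (V W : GVect_ar) :
  boundary (field_of (plus V W)) = plus (boundary (field_of V)) (boundary (field_of W)).
Proof. apply boundary_eq; exact (boundary_values_plus (boundary_spec V) (boundary_spec W)). Qed.

Lemma boundary_scal (c : R) (V : GVect_ar) :
  boundary (field_of (scal c V)) = scal c (boundary (field_of V)).
Proof. apply boundary_eq; exact (boundary_values_scal c (boundary_spec V)). Qed.

Lemma boundary_bracket (V W : GVect_ar) :
  boundary (field_of (bracket V W)) = bracket (boundary (field_of V)) (boundary (field_of W)).
Proof.
apply boundary_eq; exact (boundary_values_bracket (field_of_radial V) (field_of_radial W)
  (boundary_spec V) (boundary_spec W)).
Qed.

(** By linearity this is the identification of the kernel, [boundary_values_zero], applied to the
    difference. It gives both that the map descends to the quotient and that it is injective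
    there. *)
Lemma boundary_eqP (V W : GVect_ar) :
  boundary (field_of V) = boundary (field_of W) <-> Vect_az (minus V W).
Proof.
assert (M : boundary (field_of (minus V W))
  = minus (boundary (field_of V)) (boundary (field_of W))).
{ unfold minus; rewrite boundary_plus, <- (scal_opp_one W), boundary_scal.
  now rewrite (scal_opp_one (boundary (field_of W))). }
pose proof (boundary_spec (minus V W)) as S; rewrite M in S.
split; intros H.
- rewrite H, minus_eq_zero in S; exact (proj1 (boundary_values_zero _) S).
- pose proof (boundary_values_unique S (proj2 (boundary_values_zero _) H)) as E.
  rewrite <- (plus_zero_r (boundary (field_of W))), <- E.
  abel (semidirect VectS1_action).
Qed.

(** * The isomorphism *)

(** The second clause determines [Phi], by [boundary_values_unique] and because every class comes
    from a field: this is the sense in which the isomorphism is canonical. *)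
Theorem proposition6p17 :
  exists Phi : quotient_lie Vect_az -> semidirect VectS1_action,
    is_lie_iso Phi /\
    forall V : GVect_ar,
      near_circle (fun r t =>
        comp_theta (field_of V) r t
          = circle_fun (fst (Phi (quotient_map Vect_az V))) t /\
        comp_r (field_of V) r t
          = circle_fun (snd (Phi (quotient_map Vect_az V))) t).
Proof.
(* [Phi] is computed on a chosen representative; [K] removes the choice, and [R] reduces each
   identity to classes of fields. *)
pose (Phi (A : quotient_lie Vect_az) := boundary (field_of (quot_rep A))).
assert (K : forall V, Phi (quotient_map Vect_az V) = boundary (field_of V)).
{ intros V; apply boundary_eqP; exact (quot_rep_cls Vect_az V). }
assert (R : forall A : quotient_lie Vect_az, exists V, quotient_map Vect_az V = A).
{ intros A; exists (quot_rep A); exact (quot_repK A). }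
exists Phi; split; [split|].
- intros A B; destruct (R A) as [V <-], (R B) as [W <-].
  rewrite !K, <- boundary_plus, <- K; f_equal; exact (quot_plus_cls Vect_az V W).
- intros c A; destruct (R A) as [V <-].
  rewrite !K, <- boundary_scal, <- K; f_equal; exact (quot_scal_cls Vect_az c V).
- intros A B; destruct (R A) as [V <-], (R B) as [W <-].
  rewrite !K, <- boundary_bracket, <- K; f_equal; exact (quot_bracket_cls Vect_az V W).
- intros A B; destruct (R A) as [V <-], (R B) as [W <-].
  rewrite !K; intros E; apply quot_clsP; now apply boundary_eqP.
- intros p; destruct (boundary_values_surj p) as [V HV].
  exists (quotient_map Vect_az V); rewrite K; now apply boundary_eq.
- intros V; rewrite K; apply boundary_spec.
Qed.
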